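(* There is a deterministic polynomial-time classical algorithm for computing the Kostka number $K^\mu_\nu$ for partitions $\mu,\nu \vdash n$ such that $d_\nu \leq \mathrm{poly}(n)$ (i.e., for every polynomial $p$, the algorithm runs in time polynomial in $n$ on all inputs with $d_\nu\le p(n)$).
   Context: A partition $\nu\vdash n$ is a weakly decreasing sequence of positive integers summing to $n$. $d_\nu$ denotes the dimension of the irreducible representation of the symmetric group $S_n$ labelled by $\nu$ (equivalently, the number of standard Young tableaux of shape $\nu$). A semistandard Young tableau of shape $\nu$ and content $\mu$ is a filling of the Young diagram of $\nu$ with positive integers, where the integer $i$ appears exactly $\mu_i$ times, such that entries are weakly increasing along each row and strictly increasing down each column. The Kostka number $K^\mu_\nu$ is the number of semistandard Young tableaux of shape $\nu$ and content $\mu$ (equivalently, the multiplicity of the trivial representation of the Young subgroup $S_{\mu_1}\times S_{\mu_2}\times\cdots$ in the restriction of the $S_n$-irrep $\nu$). *)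

(* Defs.v *)
From mathcomp Require Import all_boot.
Set Implicit Arguments. Unset Strict Implicit. Unset Printing Implicit Defensive.

Definition is_partition (n : nat) (nu : seq nat) : bool :=
  [&& sorted geq nu, all (fun m => 0 < m) nu & sumn nu == n].

(* A filling of the Young diagram of nu by integers in {1..m}, encoded as a
   finite function on the bounding box 'I_(size nu) * 'I_(nu_1) with values
   in 'I_m.+1, where value 0 marks exactly the cells outside the diagram. *)
Definition filling (nu : seq nat) (m : nat) :=
  {ffun 'I_(size nu) * 'I_(head 0 nu) -> 'I_m.+1}.

Definition in_shape (nu : seq nat) m (T : filling nu m) : bool :=
  [forall i : 'I_(size nu), forall j : 'I_(head 0 nu), (j < nth 0 nu i) == (T (i, j) != ord0)].

Definition cols_strict (nu : seq nat) m (T : filling nu m) : bool :=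
  [forall i : 'I_(size nu), forall i' : 'I_(size nu), forall j : 'I_(head 0 nu),
     ((i < i') && (j < nth 0 nu i')) ==> (T (i, j) < T (i', j))].

Definition rows_weak (nu : seq nat) m (T : filling nu m) : bool :=
  [forall i : 'I_(size nu), forall j : 'I_(head 0 nu), forall j' : 'I_(head 0 nu),
     ((j <= j') && (j' < nth 0 nu i)) ==> (T (i, j) <= T (i, j'))].

Definition rows_strict (nu : seq nat) m (T : filling nu m) : bool :=
  [forall i : 'I_(size nu), forall j : 'I_(head 0 nu), forall j' : 'I_(head 0 nu),
     ((j < j') && (j' < nth 0 nu i)) ==> (T (i, j) < T (i, j'))].

Definition has_content (nu : seq nat) m (T : filling nu m) (c : nat -> nat) : bool :=
  [forall k : 'I_m, #|[set x | val (T x) == k.+1]| == c k].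

Definition ssyt (mu nu : seq nat) (T : filling nu (size mu)) : bool :=
  [&& in_shape T, rows_weak T, cols_strict T & has_content T (nth 0 mu)].

Definition kostka (mu nu : seq nat) : nat := #|[set T | @ssyt mu nu T]|.

Definition syt (nu : seq nat) (T : filling nu (sumn nu)) : bool :=
  [&& in_shape T, rows_strict T, cols_strict T & has_content T (fun _ => 1)].

Definition dim_irr (nu : seq nat) : nat := #|[set T | @syt nu T]|.

Inductive bsym := Blank | Zero | One | Sep.

Record TM := {
  tm_states : nat;
  tm_work : nat;
  (* None = halt; Some (q', s', true) = write s', go to q', move right;
     false = move left *)
  tm_delta : 'I_tm_states.+1 -> (bsym + 'I_tm_work)%type ->
             option ('I_tm_states.+1 * (bsym + 'I_tm_work) * bool)
}.

Definition tsym (M : TM) := (bsym + 'I_(tm_work M))%type.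

(* configuration: state, left part (nearest cell first), scanned symbol,
   right part; all cells beyond are blank *)
Record config (M : TM) := Config {
  c_state : 'I_(tm_states M).+1;
  c_left : seq (tsym M);
  c_cur : tsym M;
  c_right : seq (tsym M)
}.

Definition step (M : TM) (c : config M) : option (config M) :=
  match tm_delta (c_state c) (c_cur c) with
  | None => None
  | Some (q, s, true) =>
      Some (Config q (s :: c_left c) (head (inl Blank) (c_right c)) (behead (c_right c)))
  | Some (q, s, false) =>
      Some (Config q (behead (c_left c)) (head (inl Blank) (c_left c)) (s :: c_right c))
  end.

Definition halted (M : TM) (c : config M) : bool :=
  if tm_delta (c_state c) (c_cur c) is None then true else false.

Fixpoint run (M : TM) (t : nat) (c : config M) : config M :=
  match t with
  | 0 => c
  | t'.+1 => match step c with None => c | Some c' => run t' c' end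
  end.

Definition init (M : TM) (inp : seq bsym) : config M :=
  Config (ord0 : 'I_(tm_states M).+1) [::] (inl (head Blank inp))
         [seq inl s | s <- behead inp].

Fixpoint bits_val (M : TM) (s : seq (tsym M)) : nat :=
  match s with
  | inl Zero :: s' => (bits_val s').*2
  | inl One :: s' => (bits_val s').*2.+1
  | _ => 0
  end.

Definition output (M : TM) (c : config M) : nat := bits_val (c_cur c :: c_right c).

Definition computes_within (M : TM) (inp : seq bsym) (t out : nat) : Prop :=
  let c := run t (init M inp) in halted c /\ output c = out.

Definition enc_part (la : seq nat) : seq bsym :=
  flatten [seq rcons (nseq m One) Sep | m <- la].

Definition enc_pair (mu nu : seq nat) : seq bsym :=
  enc_part mu ++ Zero :: enc_part nu.

(* Main.v *)
(* Write nu as its boundary word, a bar (Sep) for every row and a letter One for every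
   column, so that removing a corner box means replacing a factor Sep One by One Sep.
   A semistandard tableau of content mu is peeled off box by box, largest entries
   first; within the boxes of one entry the rows may be taken in increasing order, so
   a cursor sweeps over the word once per part of mu and at every Sep One branches
   between removing the box and moving on. The machine explores this binary tree by
   backtracking and counts the accepting leaves. Some branches die, but a branching is
   determined by the sequence of at most n boxes ending with the one it may remove, and
   every such sequence extends to a standard tableau of shape nu, so there are at most
   n * d_nu branchings and 1 + n * d_nu leaves; the depth of the tree is quadratic. *)
From HB Require Import structures.
Require Import Defs.
From mathcomp Require Import all_boot.
From mathcomp Require Import zify.
Set Implicit Arguments. Unset Strict Implicit. Unset Printing Implicit Defensive.

(** * Stack machines and their simulation by Turing machines *)

Definition bsym_code (x : bsym) : nat :=
  match x with Blank => 0 | Zero => 1 | One => 2 | Sep => 3 end.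

Lemma bsym_codeK : pcancel bsym_code (onth [:: Blank; Zero; One; Sep]).
Proof. by case. Qed.

HB.instance Definition _ := Countable.copy bsym (pcan_type bsym_codeK).

Lemma bsym_enumP : Finite.axiom [:: Blank; Zero; One; Sep].
Proof. by case. Qed.

HB.instance Definition _ := isFinite.Build bsym bsym_enumP.

(** Carry propagation with the least significant digit first, the order in which [bits_val] reads
    the output. *)
Fixpoint binc (s : seq bsym) : seq bsym :=
  match s with
  | One :: s' => Zero :: binc s'
  | _ :: s' => One :: s'
  | [::] => [:: One]
  end.

Lemma size_binc s : size s <= size (binc s) <= (size s).+1.
Proof. by elim: s => [|[] s IH] //=; rewrite ?leqnn ?leqnSn // !ltnS. Qed.

Fixpoint bval (s : seq bsym) : nat :=
  match s with
  | Zero :: s' => (bval s').*2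
  | One :: s' => (bval s').*2.+1
  | _ => 0
  end.

Lemma bval_binc s : all (predU1 Zero (pred1 One)) s ->
  all (predU1 Zero (pred1 One)) (binc s) /\ bval (binc s) = (bval s).+1.
Proof.
elim: s => [|x s IH] //= /andP[hx hs]; case: (IH hs) => hb vb.
by case: x hx => //= _; rewrite ?hs ?hb ?vb ?doubleS.
Qed.

(** * Runs of a Turing machine and time bounds for them *)

Section TuringMachine.
Variable M : TM.

(** Unlike [run], which stays at a halting configuration, this demands that all [t] steps take
    place, so that step counts add up exactly. *)
Definition tsteps t (c c' : config M) := iter t (obind (@step M)) (Some c) = Some c'.

Lemma tsteps_add t u c c1 c2 : tsteps t c c1 -> tsteps u c1 c2 -> tsteps (u + t) c c2.
Proof. by rewrite /tsteps iterD => ->. Qed.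

Lemma tsteps_run t u c c' : tsteps t c c' -> run (t + u) c = run u c'.
Proof.
have iterN n : iter n (obind (@step M)) None = None by elim: n => //= n ->.
elim: t c => [|t IH] c; first by case=> ->.
by rewrite /tsteps iterSr /=; case: (step c) => [c1|]; [exact: IH | rewrite iterN].
Qed.

Lemma step_halted (c : config M) : halted c -> step c = None.
Proof. by rewrite /halted /step; case: tm_delta. Qed.

Definition leads c t (P : config M -> Prop) :=
  exists t' c', [/\ t' <= t, tsteps t' c c' & P c'].

Lemma leads_refl c (P : config M -> Prop) : P c -> leads c 0 P.
Proof. by exists 0, c. Qed.

Lemma leads_trans c t u (P R : config M -> Prop) :
  leads c t P -> (forall c', P c' -> leads c' u R) -> leads c (t + u) R.
Proof.
move=> [t1 [c1 [le1 s1 p1]]] /(_ _ p1) [t2 [c2 [le2 s2 p2]]].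
by exists (t2 + t1), c2; split=> //; [rewrite addnC leq_add | exact: tsteps_add s2].
Qed.

Lemma leads_weaken c t u (P : config M -> Prop) : t <= u -> leads c t P -> leads c u P.
Proof. by move=> tu [t1 [c1 [le1 s1 p1]]]; exists t1, c1; split=> //; exact: leq_trans tu. Qed.

Lemma leads_step c c' t (P : config M -> Prop) :
  step c = Some c' -> leads c' t P -> leads c t.+1 P.
Proof.
move=> sc [t1 [c1 [le1 s1 p1]]]; exists t1.+1, c1; split=> //.
by rewrite /tsteps iterSr /= sc.
Qed.

Lemma leads_computes inp t out :
  leads (init M inp) t (fun c => halted c /\ output c = out) ->
  computes_within M inp t out.
Proof.
move=> [t1 [c1 [le1 s1 [h1 o1]]]].
rewrite /computes_within -(subnKC le1) (tsteps_run _ s1).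
by case: (t - t1) => [|u] /=; rewrite ?(step_halted h1).
Qed.

End TuringMachine.

(** * Programs on several stacks and the Turing machine that simulates them *)

Inductive instr (Q K : Type) :=
| Push (k : K) (x : bsym) (q : Q)
| Pop (k : K) (next : option bsym -> Q)
| Inc (k : K) (q : Q)
| Done (k : K).
Arguments Done {Q K}.

Definition is_done Q K (i : instr Q K) := if i is Done _ then true else false.

Section StackMachine.
Variables (Q K : finType) (prog : Q -> instr Q K) (q0 : Q) (kin : K).
Variables (St : Type) (get : K -> St -> seq bsym) (put : K -> seq bsym -> St -> St).
Hypothesis get_put :
  forall k k' s S, get k' (put k s S) = if k' == k then s else get k' S.

(* The top of a stack is its head; [Inc] sees the stack as a binary number whose
   least significant digit is at the bottom. *)
Definition sstep (c : Q * St) : Q * St :=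
  let: (q, Z) := c in
  match prog q with
  | Push k x q' => (q', put k (x :: get k Z) Z)
  | Pop k next => (next (ohead (get k Z)), put k (behead (get k Z)) Z)
  | Inc k q' => (q', put k (rev (binc (rev (get k Z)))) Z)
  | Done _ => c
  end.

(* One tape cell holds one symbol of each stack. *)
Definition cell := {ffun K -> option bsym}.
Definition setc (x : cell) k o : cell := [ffun k' => if k' == k then o else x k'].

Inductive mode :=
| Go of Q          (* search rightwards for the end of a stack *)
| Take of Q        (* on the top symbol of the stack to be popped *)
| Ret of K & Q     (* return leftwards to the first cell *)
| Conv of K        (* return leftwards, writing the output *)
| Fin.

Definition mode_code (s : mode) : Q + Q + (K * Q) + K + unit :=
  match s with
  | Go q => inl (inl (inl (inl q)))
  | Take q => inl (inl (inl (inr q)))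
  | Ret k q => inl (inl (inr (k, q)))
  | Conv k => inl (inr k)
  | Fin => inr tt
  end.

Definition mode_decode (s : Q + Q + (K * Q) + K + unit) : mode :=
  match s with
  | inl (inl (inl (inl q))) => Go q
  | inl (inl (inl (inr q))) => Take q
  | inl (inl (inr (k, q))) => Ret k q
  | inl (inr k) => Conv k
  | inr tt => Fin
  end.

Lemma mode_codeK : cancel mode_code mode_decode.
Proof. by case. Qed.

(** Each instruction starts with the head on the first cell and brings it back there. The first
    empty cell on track [k] marks the end of that stack, so [Push], [Pop] and [Done] walk to it,
    while [Inc] works at once because the lowest digit sits in the first cell. *)
Definition delta (s : mode) (x : cell) : option (mode * (bsym + cell) * bool) :=
  match s with
  | Go q =>
    match prog q with
    | Push k a q' =>
      if x k is Some _ then Some (Go q, inr x, true)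
      else Some (Ret k q', inr (setc x k (Some a)), false)
    | Pop k _ =>
      if x k is Some _ then Some (Go q, inr x, true) else Some (Take q, inr x, false)
    | Inc k q' =>
      if x k is Some One then Some (Go q, inr (setc x k (Some Zero)), true)
      else Some (Ret k q', inr (setc x k (Some One)), false)
    | Done k =>
      if x k is Some _ then Some (Go q, inr x, true) else Some (Conv k, inl Blank, false)
    end
  | Take q =>
    if prog q is Pop k next then
      if x k is Some a then Some (Ret k (next (Some a)), inr (setc x k None), false)
      else Some (Go (next None), inr x, true)
    else None
  | Ret k q =>
    if x k is Some _ then Some (Ret k q, inr x, false) else Some (Go q, inr x, true)
  | Conv k => if x k is Some a then Some (Conv k, inl a, false) else Some (Fin, inr x, true)
  | Fin => None
  end.

Definition modes := (Q + Q + (K * Q) + K + unit)%type.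
Definition nmodes := #|{: modes}|.

(* State 0 is an additional copy of the initial mode. *)
Definition dec_mode (i : 'I_nmodes.+1) : mode :=
  if unlift ord0 i is Some j then mode_decode (enum_val j) else Go q0.
Definition enc_mode (s : mode) : 'I_nmodes.+1 := lift ord0 (enum_rank (mode_code s)).

Lemma enc_modeK : cancel enc_mode dec_mode.
Proof. by move=> s; rewrite /dec_mode liftK enum_rankK mode_codeK. Qed.

Definition wsym := (bsym + 'I_#|{: cell}|)%type.

(** A plain symbol is read as an entry of the input track alone, so the untouched input tape already
    represents the initial stacks. *)
Definition dec_cell (y : wsym) : cell :=
  match y with
  | inl Blank => [ffun=> None]
  | inl a => setc [ffun=> None] kin (Some a)
  | inr i => enum_val i
  end.

Lemma dec_cell_inl a k :
  dec_cell (inl a) k = if (a != Blank) && (k == kin) then Some a else None.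
Proof. by case: a; rewrite /dec_cell /setc !ffunE //=; case: eqP. Qed.

Definition enc_cell (y : bsym + cell) : wsym :=
  match y with inl a => inl a | inr x => inr (enum_rank x) end.

Definition machine : TM :=
  {| tm_states := nmodes; tm_work := #|{: cell}|;
     tm_delta := fun i y =>
       omap (fun r : mode * (bsym + cell) * bool =>
               let: (s, z, d) := r in (enc_mode s, enc_cell z, d))
            (delta (dec_mode i) (dec_cell y)) |}.

(* The tape content g is indexed so that cell 1 is the initial cell; cell 0
   always stays empty and marks the left end. *)
Definition rep (c : config machine) (s : mode) (p : nat) (g : nat -> cell) : Prop :=
  [/\ dec_mode (c_state c) = s,
      dec_cell (c_cur c) = g p,
      forall i, dec_cell (nth (inl Blank) (c_right c) i) = g (p + i).+1 &
      forall i, i < p -> dec_cell (nth (inl Blank) (c_left c) i) = g (p - i.+1)].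

Definition updg (g : nat -> cell) p x := fun i => if i == p then x else g i.

Lemma rep_right c s p g s' z : rep c s p g -> delta s (g p) = Some (s', z, true) ->
  exists2 c', step c = Some c' &
    rep c' s' p.+1 (updg g p (dec_cell (enc_cell z))) /\
    c_cur c' :: c_right c' = head (inl Blank) (c_right c) :: behead (c_right c).
Proof.
case: c => q l x r [/= hq hx hr hl] hd.
exists (@Config machine (enc_mode s') (enc_cell z :: l) (head (inl Blank) r) (behead r)).
  by rewrite /step /= hq hx hd.
split=> //; split=> [||i|[|i] ip] /=; rewrite /updg.
- exact: enc_modeK.
- by rewrite -nth0 hr addn0 ifN // gtn_eqF.
- by rewrite nth_behead hr addSnnS ifN //; lia.
- by rewrite subSS subn0 eqxx.
- rewrite hl; last by lia.
  by rewrite ifN; [congr (g _); lia | lia].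
Qed.

Lemma rep_left c s p g s' z : rep c s p.+1 g -> delta s (g p.+1) = Some (s', z, false) ->
  exists2 c', step c = Some c' &
    rep c' s' p (updg g p.+1 (dec_cell (enc_cell z))) /\ c_right c' = enc_cell z :: c_right c.
Proof.
case: c => q l x r [/= hq hx hr hl] hd.
exists (@Config machine (enc_mode s') (behead l) (head (inl Blank) l) (enc_cell z :: r)).
  by rewrite /step /= hq hx hd.
split=> //; split=> [||[|i]|i ip] /=; rewrite /updg.
- exact: enc_modeK.
- by rewrite -nth0 hl // subSS subn0 ifN //; lia.
- by rewrite addn0 eqxx.
- by rewrite hr ifN; [congr (g _); lia | lia].
- by rewrite nth_behead hl ?ifN //; lia.
Qed.

Lemma eq_rep c s p g g' : g =1 g' -> rep c s p g -> rep c s p g'.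
Proof. by move=> e [h1 h2 h3 h4]; split=> // *; rewrite -e; auto. Qed.

Lemma updg_id g p x : x = g p -> updg g p x =1 g.
Proof. by move=> -> i; rewrite /updg; case: eqP => // ->. Qed.

Lemma dec_enc_inr (x : cell) : dec_cell (enc_cell (inr x)) = x.
Proof. by rewrite /= enum_rankK. Qed.

(** The stacks are aligned at their bottoms in cell 1 and grow to the right, hence the reversal. *)
Definition tape_of (S : St) (g : nat -> cell) : Prop :=
  forall k, g 0 k = None /\ forall i, g i.+1 k = onth (rev (get k S)) i.

Lemma walk_right c s p d g :
  rep c s p g ->
  (forall i, p <= i < p + d -> delta s (g i) = Some (s, inr (g i), true)) ->
  leads c d (fun c' => rep c' s (p + d) g).
Proof.
elim: d c p => [|d IH] c p h hd; first by rewrite addn0; apply: leads_refl.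
have [|c1 s1 [r1 _]] := rep_right h (hd p _); first by lia.
apply: leads_step s1 _; rewrite -addSnnS; apply: IH => [|i hi]; last by apply: hd; lia.
by apply: eq_rep r1; apply: updg_id; rewrite dec_enc_inr.
Qed.

Lemma walk_back c k q p g :
  rep c (Ret k q) p g -> g 0 k = None -> (forall i, 0 < i <= p -> g i k) ->
  leads c p.+1 (fun c' => rep c' (Go q) 1 g).
Proof.
elim: p c => [|p IH] c h g0 hd.
  have [|c1 s1 [r1 _]] := @rep_right _ _ _ _ (Go q) (inr (g 0)) h; first by rewrite /= g0.
  apply: leads_step s1 _; apply: leads_refl; apply: eq_rep r1.
  by apply: updg_id; rewrite dec_enc_inr.
have [|c1 s1 [r1 _]] := @rep_left _ _ _ _ (Ret k q) (inr (g p.+1)) h.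
  by rewrite /=; case: (g p.+1 k) (hd p.+1 (leqnn _)).
apply: leads_step s1 _; apply: IH => // [|i /andP[i0 ip]]; last by rewrite hd // i0 leqW.
by apply: eq_rep r1; apply: updg_id; rewrite dec_enc_inr.
Qed.

Lemma onth_rev_top (s : seq bsym) : onth (rev s) (size s) = None.
Proof. by rewrite onth_default ?size_rev. Qed.

Lemma go_end c q k S g : (if prog q is Inc _ _ then False else True) ->
  (match prog q with Push k' _ _ => k' | Pop k' _ => k' | Inc k' _ => k' | Done k' => k' end) = k ->
  rep c (Go q) 1 g -> tape_of S g ->
  leads c (size (get k S)) (fun c' => rep c' (Go q) (size (get k S)).+1 g).
Proof.
move=> hni hk h tg; rewrite -[_.+1]add1n; apply: walk_right h _ => -[|i] //= hi.
have : g i.+1 k by rewrite (tg k).2 onthTE size_rev; lia.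
by case: (prog q) hni hk => //= [k' x q'|k' n|k'] _ ->; case: (g i.+1 k).
Qed.

(** Induction on the part [u] of the track from the head on: the carry passes over ones and is
    absorbed by the first other symbol or the first empty cell. The bound on [p'] limits the way
    back. *)
Lemma go_inc c q k q' p g u :
  prog q = Inc k q' -> rep c (Go q) p.+1 g -> (forall i, g (p + i).+1 k = onth u i) ->
  leads c (size u).+1 (fun c' => exists p' g',
    [/\ rep c' (Ret k q') p' g', p' <= p + size u,
        forall i k', (i <= p) || (k' != k) -> g' i k' = g i k' &
        forall i, g' (p + i).+1 k = onth (binc u) i]).
Proof.
move=> hq; elim: u c p g => [|x u IH] c p g h hg; have gx := hg 0; rewrite addn0 /= in gx.
  have [|c1 s1 [r1 _]] := @rep_left _ _ _ _ (Ret k q') (inr (setc (g p.+1) k (Some One))) h.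
    by rewrite /= hq gx.
  apply: leads_step s1 _; apply: leads_refl; exists p, (updg g p.+1 (setc (g p.+1) k (Some One))).
  rewrite dec_enc_inr in r1; split=> // [|i k' /orP[ip|kk]|i].
  - by rewrite addn0.
  - by rewrite /updg ifN //; lia.
  - by rewrite /updg; case: eqP => // ->; rewrite ffunE (negPf kk).
  - rewrite /updg; case: i => [|i]; first by rewrite addn0 eqxx ffunE eqxx.
    by rewrite ifN; [rewrite hg /= !onth0n | lia].
have [ex|nx] := eqVneq x One.
- have [|c1 s1 [r1 _]] := @rep_right _ _ _ _ (Go q) (inr (setc (g p.+1) k (Some Zero))) h.
    by rewrite /= hq gx ex.
  rewrite dec_enc_inr in r1; apply: leads_step s1 _.
  set g1 := updg _ _ _ in r1.
  have hg1 i : g1 (p.+1 + i).+1 k = onth u i by rewrite /g1 /updg ifN; [rewrite addSnnS hg | lia].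
  apply: leads_weaken (leads_trans (u := 0) (IH _ _ _ r1 hg1) _) => [|c2 [p' [g' [r2 pp e1 e2]]]].
    by rewrite addn0.
  apply: leads_refl; exists p', g'; split=> // [|i k' hi|[|i]]; first by rewrite /=; lia.
  - rewrite e1; last by case/orP: hi => [|->]; [lia | rewrite orbT].
    rewrite /g1 /updg; case: eqP => // ei; rewrite ffunE ei.
    by case: (k' =P k) hi => // _ /=; lia.
  - by rewrite addn0 e1 ?leqnn // /g1 /updg eqxx ffunE eqxx ex.
  - by rewrite -addSnnS e2 ex.
- have [|c1 s1 [r1 _]] := @rep_left _ _ _ _ (Ret k q') (inr (setc (g p.+1) k (Some One))) h.
    by rewrite /= hq gx; case: (x) nx.
  apply: leads_weaken (leads_step s1 (leads_refl _)) => //.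
  exists p, (updg g p.+1 (setc (g p.+1) k (Some One))).
  rewrite dec_enc_inr in r1; split=> // [|i k' /orP[ip|kk]|i].
  - by lia.
  - by rewrite /updg ifN //; lia.
  - by rewrite /updg; case: eqP => // ->; rewrite ffunE (negPf kk).
  - have -> : binc (x :: u) = One :: u by case: (x) nx.
    rewrite /updg; case: i => [|i]; first by rewrite addn0 eqxx ffunE eqxx.
    by rewrite ifN; [rewrite hg | lia].
Qed.

Lemma tape_put S (g g' : nat -> cell) k s : tape_of S g ->
  (forall i k', (i == 0) || (k' != k) -> g' i k' = g i k') ->
  (forall i, g' i.+1 k = onth (rev s) i) -> tape_of (put k s S) g'.
Proof.
move=> tg e1 e2 k'; split=> [|i]; first by rewrite e1 // (tg k').1.
rewrite get_put; case: eqP => [->|/eqP kk]; first exact: e2.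
by rewrite e1 ?kk ?orbT // (tg k').2.
Qed.

(** A track of height at most [H] is crossed at most once in either direction; a constant number of
    steps goes into turning round. *)
Lemma sstep_leads c q S g H :
  ~~ is_done (prog q) ->
  rep c (Go q) 1 g -> tape_of S g -> (forall k, size (get k S) <= H) ->
  leads c (H.*2 + 4) (fun c' => exists2 g',
    rep c' (Go (sstep (q, S)).1) 1 g' & tape_of (sstep (q, S)).2 g').
Proof.
move=> hd h tg hH; rewrite /sstep; case e: (prog q) hd => [k a q'|k f|k q'|//] _ /=.
- apply: (@leads_weaken _ _ (size (get k S) + (size (get k S) + 2).+1)).
    by have := hH k; lia.
  apply: leads_trans (go_end (k := k) _ _ h tg) _; rewrite ?e // => c1 r1.
  set p := size (get k S).
  have gp : g p.+1 k = None by rewrite (tg k).2 onth_rev_top.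
  have [|c2 s2 [r2 _]] := @rep_left _ _ _ _ (Ret k q') (inr (setc (g p.+1) k (Some a))) r1.
    by rewrite /= e gp.
  rewrite dec_enc_inr in r2; apply: leads_step s2 _.
  set g1 := updg _ _ _ in r2.
  have t1 : tape_of (put k (a :: get k S) S) g1.
    apply: (tape_put tg) => [i k' hi|i]; rewrite /g1 /updg; last first.
      rewrite rev_cons -cats1 onth_cat size_rev -/p eqSS.
      have [->|ip] := eqVneq i p; first by rewrite ltnn subnn ffunE eqxx.
      rewrite (tg k).2; case: ltnP => // pi.
      by rewrite !onth_default ?size_rev //=; lia.
    by case: (i =P p.+1) hi => // -> /= hi; rewrite ffunE (negPf hi).
  apply: (@leads_weaken _ _ (p.+1 + 0)); first by rewrite /p; lia.
  apply: leads_trans (walk_back r2 _ _) _ => [|i hi|c3 r3]; first exact: (t1 k).1.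
  + by case: i hi => // i hi; rewrite (t1 k).2 onthTE size_rev get_put eqxx /=; lia.
  + by apply: leads_refl; exists g1.
- apply: (@leads_weaken _ _ (size (get k S) + (size (get k S) + 1).+2)).
    by have := hH k; lia.
  apply: leads_trans (go_end (k := k) _ _ h tg) _; rewrite ?e // => c1 r1.
  have gp : g (size (get k S)).+1 k = None by rewrite (tg k).2 onth_rev_top.
  have [|c2 s2 [r2 _]] := @rep_left _ _ _ _ (Take q) (inr (g (size (get k S)).+1)) r1.
    by rewrite /= e gp.
  apply: leads_step s2 _; rewrite dec_enc_inr in r2.
  have {gp r1} r2 := eq_rep (updg_id erefl) r2.
  case ek: (get k S) r2 => [|a s] /= r2.
  + have [|c3 s3 [r3 _]] := @rep_right _ _ _ _ (Go (f None)) (inr (g 0)) r2.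
      by rewrite /= e (tg k).1.
    apply: leads_step s3 _; apply: leads_weaken (leads_refl _) => //.
    rewrite dec_enc_inr in r3; exists g; first exact: eq_rep (updg_id erefl) r3.
    by apply: (tape_put tg) => // i; rewrite (tg k).2 ek.
  + have ga : g (size s).+1 k = Some a.
      by rewrite (tg k).2 ek rev_cons -cats1 onth_cat size_rev ltnn subnn.
    have [|c3 s3 [r3 _]] := @rep_left _ _ _ _ (Ret k (f (Some a)))
                               (inr (setc (g (size s).+1) k None)) r2.
      by rewrite /= e ga.
    rewrite dec_enc_inr in r3; apply: leads_step s3 _.
    set g1 := updg _ _ _ in r3.
    have t1 : tape_of (put k s S) g1.
      apply: (tape_put tg) => [i k' hi|i]; rewrite /g1 /updg.
        by case: (i =P (size s).+1) hi => // -> /= hi; rewrite ffunE (negPf hi).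
      rewrite eqSS; have [->|ip] := eqVneq i (size s).
        by rewrite ffunE eqxx onth_rev_top.
      rewrite (tg k).2 ek rev_cons -cats1 onth_cat size_rev; case: ltnP => // pi.
      by rewrite !onth_default ?size_rev //=; lia.
    apply: (@leads_weaken _ _ ((size s).+1 + 0)); first by lia.
    apply: leads_trans (walk_back r3 _ _) _ => [|i hi|c4 r4]; first exact: (t1 k).1.
    * by case: i hi => // i hi; rewrite (t1 k).2 onthTE size_rev get_put eqxx; lia.
    * by apply: leads_refl; exists g1.
- have hu i : g (0 + i).+1 k = onth (rev (get k S)) i by rewrite (tg k).2.
  apply: (@leads_weaken _ _ ((size (rev (get k S))).+1 + (H.+1 + 0))).
    by rewrite size_rev; have := hH k; lia.
  apply: leads_trans (go_inc e h hu) _ => c1 [p' [g' [r1 pp e1 e2]]].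
  have t1 : tape_of (put k (rev (binc (rev (get k S)))) S) g'.
    by apply: (tape_put tg) => [i k' hi|i]; [rewrite e1 // leqn0 | rewrite revK -e2].
  apply: (@leads_weaken _ _ (p'.+1 + 0)).
    by rewrite !addn0 ltnS (leq_trans pp) // add0n size_rev.
  apply: leads_trans (walk_back r1 _ _) _ => [|i hi|c4 r4]; first exact: (t1 k).1.
  + case: i hi => // i hi; rewrite (t1 k).2 onthTE get_put eqxx revK.
    by have /andP[] := size_binc (rev (get k S)); lia.
  + by apply: leads_refl; exists g'.
Qed.

Lemma bits_val_inl (s : seq bsym) r : all (predU1 Zero (pred1 One)) s ->
  bits_val ([seq inl x | x <- s] ++ inl Blank :: r : seq (tsym machine)) = bval s.
Proof. by elim: s => //= x s IH /andP[hx /IH <-]; case: x hx. Qed.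

(** Invariant of the final sweep to the left: the digits of [s] from [p] on already stand as plain
    symbols, closed by a blank at which [bits_val] stops. *)
Lemma conv_leads c k p g s r :
  rep c (Conv k) p g -> p <= size s -> g 0 k = None ->
  (forall i, i < p -> g i.+1 k = onth s i) ->
  c_right c = [seq inl x | x <- drop p s] ++ inl Blank :: r ->
  all (predU1 Zero (pred1 One)) s ->
  leads c p.+1 (fun c' => halted c' /\ output c' = bval s).
Proof.
move=> h ps g0 gs er bits; elim: p c g h ps g0 gs er => [|p IH] c g h ps g0 gs er.
  have [|c1 s1 [[hm _ _ _] t1]] := @rep_right _ _ _ _ Fin (inr (g 0)) h.
    by rewrite /= g0.
  apply: leads_step s1 _; apply: leads_refl; split.
    by rewrite /halted /= hm.
  rewrite /output t1 er drop0 -(bits_val_inl r bits).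
  by case: (s).
have ha : onth s p = Some (nth Blank s p) by rewrite onthE (nth_map Blank).
have [|c1 s1 [r1 t1]] := @rep_left _ _ _ _ (Conv k) (inl (nth Blank s p)) h.
  by rewrite /= gs // ha.
apply: leads_step s1 _; apply: IH r1 _ _ _ _ => // [|i ip|].
- exact: ltnW.
- by rewrite /updg ifN ?gs //; lia.
- by rewrite t1 er (drop_nth Blank ps).
Qed.

Lemma done_leads c q S g k : prog q = Done k ->
  rep c (Go q) 1 g -> tape_of S g -> all (predU1 Zero (pred1 One)) (get k S) ->
  leads c ((size (get k S)).*2 + 2)
    (fun c' => halted c' /\ output c' = bval (rev (get k S))).
Proof.
move=> e h tg bits; pose s := rev (get k S).
have sz : size s = size (get k S) by rewrite size_rev.
apply: (@leads_weaken _ _ (size (get k S) + (size (get k S)).+2)); first by lia.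
apply: leads_trans (go_end (k := k) _ _ h tg) _; rewrite ?e // => c1 r1.
have gp : g (size (get k S)).+1 k = None by rewrite (tg k).2 onth_rev_top.
have [|c2 s2 [r2 t2]] := @rep_left _ _ _ _ (Conv k) (inl Blank) r1.
  by rewrite /= e gp.
apply: leads_step s2 _; apply: (conv_leads (r := c_right c1)) r2 _ _ _ _ _.
- by rewrite size_rev.
- by rewrite /updg /= (tg k).1.
- by move=> i hi; rewrite /updg ifN ?(tg k).2 //; lia.
- by rewrite -sz drop_size t2.
- by rewrite all_rev.
Qed.

Lemma iter_sstep_done n q S k : prog q = Done k -> iter n sstep (q, S) = (q, S).
Proof. by move=> e; elim: n => //= n ->; rewrite /sstep e. Qed.

Lemma sstep_size q S H : (forall k, size (get k S) <= H) ->
  forall k, size (get k (sstep (q, S)).2) <= H.+1.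
Proof.
move=> hH k; rewrite /sstep; case: (prog q) => [k1 a q'|k1 f|k1 q'|k1] /=.
- by rewrite get_put; case: eqP => [<-|_] /=; rewrite ?ltnS // leqW.
- rewrite get_put; case: eqP => [<-|_]; last by rewrite leqW.
  by rewrite size_behead; have := hH k; lia.
- rewrite get_put; case: eqP => [<-|_]; last by rewrite leqW.
  rewrite size_rev; have /andP[_] := size_binc (rev (get k S)); rewrite size_rev.
  by have := hH k; lia.
- by rewrite leqW.
Qed.

(** One instruction raises a stack by at most one symbol, so all [n] of them run at heights at most
    [H + n]. *)
Lemma ssteps_leads n c q S g H :
  rep c (Go q) 1 g -> tape_of S g -> (forall k, size (get k S) <= H) ->
  leads c (n * ((H + n).*2 + 4)) (fun c' => exists2 g',
    rep c' (Go (iter n sstep (q, S)).1) 1 g' & tape_of (iter n sstep (q, S)).2 g').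
Proof.
elim: n c q S g H => [|n IH] c q S g H h tg hH; first by apply: leads_refl; exists g.
have [dn|nd] := boolP (is_done (prog q)).
  have [k ek] : exists k, prog q = Done k by case: (prog q) dn => // k; exists k.
  apply: (@leads_weaken _ _ 0) => //; apply: leads_refl.
  by exists g; rewrite (iter_sstep_done _ _ ek).
rewrite iterSr.
apply: (@leads_weaken _ _ ((H.*2 + 4) + (n * ((H.+1 + n).*2 + 4)))).
  by rewrite mulSn addSnnS leq_add2r; lia.
apply: leads_trans (sstep_leads nd h tg hH) _ => c1 [g1 r1 t1].
case es : (sstep (q, S)) r1 t1 => [q1 S1] r1 t1; apply: IH r1 t1 _ => k.
by have := sstep_size q hH k; rewrite es.
Qed.

Lemma ssteps_size n q S H : (forall k, size (get k S) <= H) ->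
  forall k, size (get k (iter n sstep (q, S)).2) <= H + n.
Proof.
elim: n q S H => [|n IH] q S H hH k; first by rewrite addn0.
have := sstep_size q hH; rewrite iterSr -addSnnS.
by case: (sstep (q, S)) => q1 S1 hs; apply: IH hs k.
Qed.

(** A blank decodes to an empty cell, so an input without blanks is exactly one stack with its last
    symbol on top. The factor [n.+1] accounts for the [n] instructions and the final output
    sweep. *)
Theorem machine_computes inp S0 n q S k :
  Blank \notin inp ->
  (forall k', get k' S0 = if k' == kin then rev inp else [::]) ->
  iter n sstep (q0, S0) = (q, S) -> prog q = Done k ->
  all (predU1 Zero (pred1 One)) (get k S) ->
  computes_within machine inp (n.+1 * ((size inp + n).*2 + 4)) (bval (rev (get k S))).
Proof.
move=> nb e0 en ek bits; apply: leads_computes.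
pose g i : cell := if i is j.+1 then dec_cell (nth (inl Blank) [seq inl x | x <- inp] j)
                   else [ffun=> None].
have r0 : rep (init machine inp) (Go q0) 1 g.
  split=> [||i|[|i]] //=.
  - by rewrite /dec_mode unlift_none.
  - by case: (inp).
  - by case: (inp) => [|x s] /=; rewrite ?nth_nil.
have nthE j : nth (inl Blank) [seq inl x : wsym | x <- inp] j = inl (nth Blank inp j).
  by elim: (inp) j => [|x s IH] [|j] //=; apply: IH.
have t0 : tape_of S0 g.
  move=> k'; split=> [|i]; first by rewrite /g ffunE.
  rewrite e0 /g nthE; case: eqP => [->|/eqP kk].
  - rewrite revK; case: (ltnP i (size inp)) => hi.
      have ha : onth inp i = Some (nth Blank inp i) by rewrite onthE (nth_map Blank).
      have : nth Blank inp i \in inp by apply: mem_nth.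
      rewrite ha dec_cell_inl eqxx andbT; case: eqP => // -> hb.
      by rewrite hb in nb.
    by rewrite nth_default // onth_default // dec_cell_inl.
  - by rewrite onth0n dec_cell_inl (negPf kk) andbF.
rewrite mulSn addnC.
have hH k' : size (get k' S0) <= size inp by rewrite e0; case: ifP; rewrite ?size_rev.
apply: leads_trans (ssteps_leads n r0 t0 hH) _; rewrite en /= => c1 [g1 r1 t1].
apply: leads_weaken (done_leads ek r1 t1 bits); rewrite leq_add ?leq_double //.
by have := ssteps_size n q0 hH k; rewrite en.
Qed.
End StackMachine.

(** * The backtracking program *)

(* M: the rest of mu; L, R: the boundary word left and right of the cursor;
   J: journal for backtracking; Out: result; A, B: counters for the conversion of nu. *)
Inductive stk := M | R | L | J | Out | A | B.

Definition stk_code (k : stk) : nat :=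
  match k with M => 0 | R => 1 | L => 2 | J => 3 | Out => 4 | A => 5 | B => 6 end.

Lemma stk_codeK : pcancel stk_code (onth [:: M; R; L; J; Out; A; B]).
Proof. by case. Qed.

HB.instance Definition _ := Countable.copy stk (pcan_type stk_codeK).

Lemma stk_enumP : Finite.axiom [:: M; R; L; J; Out; A; B].
Proof. by case. Qed.

HB.instance Definition _ := isFinite.Build stk stk_enumP.

Record store := Store {
  stM : seq bsym; stR : seq bsym; stL : seq bsym; stJ : seq bsym;
  stO : seq bsym; stA : seq bsym; stB : seq bsym
}.

Definition get (k : stk) (S : store) : seq bsym :=
  match k with
  | M => stM S | R => stR S | L => stL S | J => stJ S | Out => stO S | A => stA S | B => stB S
  end.

Definition put (k : stk) (s : seq bsym) (S : store) : store :=
  let: Store m r l j o a b := S in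
  match k with
  | M => Store s r l j o a b
  | R => Store m s l j o a b
  | L => Store m r s j o a b
  | J => Store m r l s o a b
  | Out => Store m r l j s a b
  | A => Store m r l j o s b
  | B => Store m r l j o a s
  end.

Lemma get_put k k' s S : get k' (put k s S) = if k' == k then s else get k' S.
Proof. by case: S; case: k; case: k'. Qed.

Inductive label :=
| Pre | PreEnd | PreSep | Mv | MvA | PreOne | PreNew | PreB
| Explore | Accept
| Rewind | RewO | RewS | RewM | RewJ | NewBlock
| Cell | Dead | AdvS | AdvM | AdvJ | CellO | AdvOO | AdvO | Swap1 | Swap2 | Swap3
| Backtrack | UnAdv | UnAdvO | UnAdvS | UnRew | UnRewO | UnRewS | UnBlock
| UnSwap1 | UnSwap2 | UnSwap3 | Halt.

Definition labels := [::
  Pre; PreEnd; PreSep; Mv; MvA; PreOne; PreNew; PreB;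
  Explore; Accept;
  Rewind; RewO; RewS; RewM; RewJ; NewBlock;
  Cell; Dead; AdvS; AdvM; AdvJ; CellO; AdvOO; AdvO; Swap1; Swap2; Swap3;
  Backtrack; UnAdv; UnAdvO; UnAdvS; UnRew; UnRewO; UnRewS; UnBlock;
  UnSwap1; UnSwap2; UnSwap3; Halt].

Definition label_code (q : label) : nat :=
  match q with
  | Pre => 0 | PreEnd => 1 | PreSep => 2 | Mv => 3 | MvA => 4 | PreOne => 5
  | PreNew => 6 | PreB => 7 | Explore => 8 | Accept => 9 | Rewind => 10 | RewO => 11
  | RewS => 12 | RewM => 13 | RewJ => 14 | NewBlock => 15 | Cell => 16 | Dead => 17
  | AdvS => 18 | AdvM => 19 | AdvJ => 20 | CellO => 21 | AdvOO => 22 | AdvO => 23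
  | Swap1 => 24 | Swap2 => 25 | Swap3 => 26 | Backtrack => 27 | UnAdv => 28
  | UnAdvO => 29 | UnAdvS => 30 | UnRew => 31 | UnRewO => 32 | UnRewS => 33
  | UnBlock => 34 | UnSwap1 => 35 | UnSwap2 => 36 | UnSwap3 => 37 | Halt => 38
  end.

Lemma label_codeK : pcancel label_code (onth labels).
Proof. by case. Qed.

HB.instance Definition _ := Countable.copy label (pcan_type label_codeK).

Lemma label_enumP : Finite.axiom labels.
Proof. by case. Qed.

HB.instance Definition _ := isFinite.Build label label_enumP.

(* Journal entries: One for an advance of the cursor, Sep for a swap, Zero for a
   step of the rewinding, Blank for the beginning of the next block of mu. *)
Definition prog (q : label) : instr label stk :=
  match q with
  | Pre => Pop M (fun x => match x with
             Some Sep => PreSep | Some One => PreOne | _ => PreEnd end)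
  | PreEnd => Push R Sep Explore
  | PreSep => Push R Sep Mv
  | Mv => Pop B (fun x => if x is Some _ then MvA else Pre)
  | MvA => Push A One Mv
  | PreOne => Pop A (fun x => if x is Some _ then PreB else PreNew)
  | PreNew => Push R One PreB
  | PreB => Push B One Pre
  | Explore => Pop M (fun x => match x with
                 None => Accept | Some One => Cell | _ => Rewind end)
  | Accept => Inc Out Backtrack
  | Rewind => Pop L (fun x => match x with
                None => NewBlock | Some One => RewO | _ => RewS end)
  | RewO => Push R One RewM
  | RewS => Push R Sep RewM
  | RewM => Push M Sep RewJ
  | RewJ => Push J Zero Explore
  | NewBlock => Push J Blank Explore
  | Cell => Pop R (fun x => match x with
              None => Dead | Some One => CellO | _ => AdvS end)
  | Dead => Push M One Backtrack
  | AdvS => Push L Sep AdvM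
  | AdvM => Push M One AdvJ
  | AdvJ => Push J One Explore
  | CellO => Pop L (fun x => match x with
               None => AdvO | Some One => AdvOO | _ => Swap1 end)
  | AdvOO => Push L One AdvO
  | AdvO => Push L One AdvM
  | Swap1 => Push L One Swap2
  | Swap2 => Push L Sep Swap3
  | Swap3 => Push J Sep Explore
  | Backtrack => Pop J (fun x => match x with
                   None => Halt | Some One => UnAdv | Some Zero => UnRew
                 | Some Blank => UnBlock | Some Sep => UnSwap1 end)
  | UnAdv => Pop L (fun x => if x is Some One then UnAdvO else UnAdvS)
  | UnAdvO => Push R One Backtrack
  | UnAdvS => Push R Sep Backtrack
  | UnRew => Pop R (fun x => if x is Some One then UnRewO else UnRewS)
  | UnRewO => Push L One Backtrack
  | UnRewS => Push L Sep Backtrack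
  | UnBlock => Push M Sep Backtrack
  | UnSwap1 => Pop L (fun=> UnSwap2)
  | UnSwap2 => Pop L (fun=> UnSwap3)
  | UnSwap3 => Push L Sep AdvO
  | Halt => Done Out
  end.

Notation next := (sstep prog get put).

Definition reach t (c c' : label * store) := exists2 t', t' <= t & iter t' next c = c'.

Lemma reach_trans t u c c1 c2 : reach t c c1 -> reach u c1 c2 -> reach (t + u) c c2.
Proof.
move=> [t1 l1 <-] [t2 l2 <-]; exists (t2 + t1); first by rewrite addnC leq_add.
by rewrite iterD.
Qed.

Lemma reach_next n t c c' : reach t (iter n next c) c' -> reach (n + t) c c'.
Proof. by apply: reach_trans; exists n. Qed.

Lemma reach_refl t c : reach t c c.
Proof. by exists 0. Qed.

Lemma reach_weaken t u c c' : t <= u -> reach t c c' -> reach u c c'.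
Proof. by move=> tu [t' lt e]; exists t' => //; apply: leq_trans tu. Qed.

Definition incr (o : seq bsym) := rev (binc (rev o)).

(** * The search tree and its traversal *)

Notation branching l r := ((ohead l == Some Sep) && (ohead r == Some One)).

(* [tree m l r c n f]: the search below the state (m, l, r) has c accepting leaves,
   n nodes and f leaves. *)
Inductive tree : seq bsym -> seq bsym -> seq bsym -> nat -> nat -> nat -> Prop :=
| TreeAccept l r : tree [::] l r 1 1 1
| TreeRewind m x l r c n f :
    tree (Sep :: m) l (x :: r) c n f -> tree (Sep :: m) (x :: l) r c n.+1 f
| TreeBlock m r c n f : tree m [::] r c n f -> tree (Sep :: m) [::] r c n.+1 f
| TreeDead m l : tree (One :: m) l [::] 0 1 1
| TreeAdvance m l x r c n f : ~~ branching l (x :: r) ->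
    tree (One :: m) (x :: l) r c n f -> tree (One :: m) l (x :: r) c n.+1 f
| TreeBranch m l r c1 n1 f1 c2 n2 f2 :
    tree m (Sep :: One :: l) r c1 n1 f1 ->
    tree (One :: m) (One :: Sep :: l) r c2 n2 f2 ->
    tree (One :: m) (Sep :: l) (One :: r) (c1 + c2) (n1 + n2).+1 (f1 + f2).

Definition word_ok (s : seq bsym) := all (predU1 One (pred1 Sep)) s.

(** The search behaves like a procedure call that restores every stack except the counter; undoing a
    swap leads straight into the second branch. A branching spends 6 + 7 + 3 steps outside its
    subtrees, every other node fewer. *)
Lemma tree_search m l r c n f : tree m l r c n f -> word_ok l -> word_ok r ->
  forall j o a b, reach (17 * n) (Explore, Store m r l j o a b)
                                 (Backtrack, Store m r l j (iter c incr o) a b).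
Proof.
elim=> {m l r c n f} [l r|m x l r c n f _ IH|m r c n f _ IH|m l|m l x r c n f nb _ IH
  |m l r c1 n1 f1 c2 n2 f2 _ IH1 _ IH2] /= okl okr j o a b.
- by apply: (@reach_next 2); apply: reach_refl.
- case/andP: okl => okx okl.
  have IHx := IH okl (introT andP (conj okx okr)) (Zero :: j) o a b.
  apply: (@reach_weaken (5 + (17 * n + (3 + 0)))); first by lia.
  by apply: reach_next; case: x okx IHx {IH} => // _ IHx; apply: reach_trans IHx _;
    apply: reach_next; apply: reach_refl.
- apply: (@reach_weaken (3 + (17 * n + (2 + 0)))); first by lia.
  apply: reach_next; apply: reach_trans (IH okl okr (Blank :: j) o a b) _.
  by apply: reach_next; apply: reach_refl.
- by apply: (@reach_next 3); apply: reach_refl.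
- case/andP: okr => okx okr.
  have IHx := IH (introT andP (conj okx okl)) okr (One :: j) o a b.
  apply: (@reach_weaken (7 + (17 * n + (3 + 0)))); first by lia.
  (* A bar is passed in 5 steps, a column step in 6 or 7 according to whether the left stack is
     empty. *)
  have E : reach 7 (Explore, Store (One :: m) (x :: r) l j o a b)
              (Explore, Store (One :: m) r (x :: l) (One :: j) o a b).
    case: x okx nb {IHx IH} => // _ nb; last by exists 5.
    case: l okl nb => [|[] l] // _ _; first by exists 6.
    by exists 7.
  apply: reach_trans E _; apply: reach_trans IHx _; apply: reach_next.
  by case: x okx {nb IH} => // _; apply: reach_refl.
- have {}IH1 := IH1 okl okr (Sep :: j) o a b.
  have {}IH2 := IH2 okl okr (One :: j) (iter c1 incr o) a b.
  apply: (@reach_weaken (6 + (17 * n1 + (7 + (17 * n2 + (3 + 0)))))); first by lia.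
  apply: reach_next; apply: reach_trans IH1 _.
  apply: reach_next; apply: reach_trans IH2 _.
  by apply: reach_next; rewrite addnC iterD; apply: reach_refl.
Qed.

Lemma iter_incr c : let o := iter c incr [::] in
  all (predU1 Zero (pred1 One)) o /\ bval (rev o) = c.
Proof.
elim: c => //= c [IH1 IH2]; have := @bval_binc (rev (iter c incr [::])).
by rewrite all_rev => /(_ IH1) [h1 h2]; rewrite /incr all_rev revK h2 IH2.
Qed.

(* The length of a row is the number of column steps right of its bar. *)
Fixpoint rowlen (w : seq bsym) : seq nat :=
  match w with
  | [::] => [::]
  | Sep :: w' => count_mem One w' :: rowlen w'
  | _ :: w' => rowlen w'
  end.

Lemma rowlen_nseq k w : rowlen (nseq k One ++ w) = rowlen w.
Proof. by elim: k. Qed.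

Lemma reach_move p i m r l j o :
  reach (2 * p + 1) (Mv, Store m r l j o (nseq i One) (nseq p One))
                    (Pre, Store m r l j o (nseq (p + i) One) [::]).
Proof.
elim: p i => [|p IH] i; first by exists 1.
apply: (@reach_weaken (2 + (2 * p + 1))); first by lia.
by apply: reach_next; have := IH i.+1; rewrite addSnnS.
Qed.

(** [A] will hold the length of the row below: it is used up first, and only the excess is written
    as column steps. [B] records the current length for the next row. *)
Lemma reach_ones k i b m r l j o :
  reach (4 * k) (Pre, Store (nseq k One ++ m) r l j o (nseq i One) (nseq b One))
    (Pre, Store m (nseq (k - i) One ++ r) l j o (nseq (i - k) One) (nseq (k + b) One)).
Proof.
elim: k i b r => [|k IH] i b r; first by rewrite sub0n subn0; apply: reach_refl.
case: i => [|i].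
  apply: (@reach_weaken (4 + 4 * k)); first by lia.
  apply: reach_next; have := IH 0 b.+1 (One :: r).
  have -> : nseq (k - 0) One ++ One :: r = nseq k.+1 One ++ r.
    by rewrite subn0; elim: (k) => //= k' ->.
  by rewrite !sub0n !subn0 addnS.
apply: (@reach_weaken (3 + 4 * k)); first by lia.
by apply: reach_next; have := IH i b.+1 r; rewrite addnS.
Qed.

(** The rows arrive from the bottom up, and [count_mem One r] is the length of the one read last. A
    row gets its bar at the symbol that follows its ones, so the very first symbol creates an
    additional empty row at the bottom. *)
Lemma reach_word rs m r : path leq (count_mem One r) rs -> word_ok r ->
  exists w a b,
    [/\ reach (6 * (size rs + sumn rs) + 2)
          (Pre, Store (flatten [seq Sep :: nseq k One | k <- rs] ++ Zero :: m) r [::] [::] [::]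
                      [::] (nseq (count_mem One r) One))
          (Explore, Store m w [::] [::] [::] a b),
        rowlen w = catrev rs (rowlen (Sep :: r)), word_ok w &
        size w = size r + size rs + last (count_mem One r) rs - count_mem One r + 1].
Proof.
elim: rs r => [|k rs IH] r /=.
  move=> _ okr; exists (Sep :: r), [::], (nseq (count_mem One r) One); split=> //=.
    by exists 2.
  by rewrite /=; lia.
case/andP=> pk prs okr; set p := count_mem One r in pk *.
pose r' := nseq (k - p) One ++ Sep :: r.
have cr : count_mem One r' = k by rewrite count_cat count_nseq /= -/p; lia.
have okr' : word_ok r' by rewrite /word_ok all_cat all_nseq orbT.
have [|//|w [a [b [h1 h2 h3 h4]]]] := IH r'; first by rewrite cr.
exists w, a, b; split=> //.
- apply: (@reach_weaken (2 + (2 * p + 1 + (4 * k + (6 * (size rs + sumn rs) + 2))))).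
    by lia.
  apply: reach_next; apply: reach_trans (reach_move _ 0 _ _ _ _ _) _.
  rewrite addn0 -catA; apply: reach_trans (reach_ones _ _ 0 _ _ _ _ _) _.
  by rewrite addn0 (eqP pk); move: h1; rewrite cr.
- by rewrite h2 /= cr /r' rowlen_nseq.
- rewrite h4 cr /r' size_cat size_nseq /=.
  have : k <= last k rs.
    by elim: (rs) (k) prs => //= x s IHs y /andP[yx /IHs]; apply: leq_trans.
  by move: pk; rewrite -/p; lia.
Qed.

Lemma rev_enc_part la : rev (enc_part la) = flatten [seq Sep :: nseq k One | k <- rev la].
Proof.
rewrite /enc_part rev_flatten -map_comp -map_rev; congr flatten.
by apply: eq_map => k /=; rewrite rev_rcons rev_nseq.
Qed.

Definition kostka_machine := machine prog Pre M.

(** The constant 3 consists of the 2 steps that end the conversion of [nu] and the last step, which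
    finds the journal empty. *)
Lemma kostka_machine_run mu nu : sorted geq nu ->
  exists w, [/\ rowlen w = rcons nu 0, word_ok w, size w = size nu + head 0 nu + 1 &
    forall c n f t, tree (rev (enc_part mu)) [::] w c n f ->
      6 * (size nu + sumn nu) + 17 * n + 3 <= t ->
      computes_within kostka_machine (enc_pair mu nu)
        (t.+1 * ((size (enc_pair mu nu) + t).*2 + 4)) c].
Proof.
move=> snu.
have pnu : path leq 0 (rev nu).
  rewrite path_min_sorted; last by apply/allP => x _.
  by rewrite rev_sorted; apply: sub_sorted snu.
have [//|//|w [a [b [h1 h2 h3 h4]]]] := @reach_word (rev nu) (rev (enc_part mu)) [::].
exists w; split=> //.
- by rewrite h2 catrevE revK cats1.
- by rewrite h4 size_rev -[in head _ _](revK nu); case/lastP: (rev nu) => [|s x];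
    rewrite ?rev_rcons ?last_rcons /=; lia.
move=> c n f t tr ht.
have := tree_search tr isT h3 [::] [::] a b.
move/(reach_trans h1)/reach_trans/(_ (@reach_next 1 0 _ _ (reach_refl _ _))) => /=.
case=> t' lt et; have [bits val] := iter_incr c.
have tt : t' <= t by move: lt; rewrite size_rev sumn_rev; lia.
rewrite -val; pose S0 := Store (rev (enc_pair mu nu)) [::] [::] [::] [::] [::] [::].
set s := Store _ w _ _ _ _ _ in et.
have et' : iter t (sstep prog get put) (Pre, S0) = (Halt, s).
  have E : rev (enc_pair mu nu) = flatten [seq Sep :: nseq k One | k <- rev nu]
                                  ++ Zero :: rev (enc_part mu).
    by rewrite /enc_pair rev_cat rev_cons cat_rcons rev_enc_part.
  by rewrite -(subnK tt) iterD /S0 E et (@iter_sstep_done _ _ prog _ get put _ Halt s Out).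
apply: (machine_computes get_put _ _ et' erefl bits) => [|[]] //.
rewrite /enc_pair mem_cat inE; apply/norP; split=> //.
  by apply/flattenP => -[_ /mapP[k _ ->]]; rewrite mem_rcons inE mem_nseq andbF.
by apply/flattenP => -[_ /mapP[k _ ->]]; rewrite mem_rcons inE mem_nseq andbF.
Qed.

(** * Removing a corner from a semistandard tableau *)

Section Tableaux.
Variables a b N : nat.
Notation box := ('I_a * 'I_b)%type.
Notation fil := {ffun box -> 'I_N.+1}.
Implicit Types (lam : nat -> nat) (T : fil) (mu : seq nat).

Definition shaped lam T : bool :=
  [forall i : 'I_a, forall j : 'I_b, (j < lam i) == (T (i, j) != ord0)].

Definition weak_rows lam T : bool :=
  [forall i : 'I_a, forall j : 'I_b, forall j' : 'I_b,
     ((j <= j') && (j' < lam i)) ==> (T (i, j) <= T (i, j'))].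

Definition strict_cols lam T : bool :=
  [forall i : 'I_a, forall i' : 'I_a, forall j : 'I_b,
     ((i < i') && (j < lam i')) ==> (T (i, j) < T (i', j))].

Definition contents mu T : bool :=
  [forall k : 'I_N, #|[set x | val (T x) == k.+1]| == nth 0 mu k].

Definition late r m T : bool := [forall x : box, (T x == m :> nat) ==> (r <= x.1)].

(* Semistandard tableaux of shape lam and content mu in which the largest
   possible entry, size mu, only occurs in the rows from r on. *)
Definition tab lam mu r : {set fil} :=
  [set T | [&& shaped lam T, weak_rows lam T, strict_cols lam T, contents mu T
             & late r (size mu) T]].

Lemma tabP lam mu r T :
  reflect [/\ forall (i : 'I_a) (j : 'I_b), (j < lam i) = (T (i, j) != ord0),
              forall (i : 'I_a) (j j' : 'I_b),
                j <= j' -> j' < lam i -> T (i, j) <= T (i, j'),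
              forall (i i' : 'I_a) (j : 'I_b), i < i' -> j < lam i' -> T (i, j) < T (i', j),
              forall k, k < N -> #|[set x | T x == k.+1 :> nat]| = nth 0 mu k &
              forall x, T x = size mu :> nat -> r <= x.1]
          (T \in tab lam mu r).
Proof.
rewrite inE; apply: (iffP and5P) => -[h1 h2 h3 h4 h5]; split.
- by move=> i j; move/forallP/(_ i)/forallP/(_ j)/eqP: h1.
- move=> i j j' jj jl; move/forallP/(_ i)/forallP/(_ j)/forallP/(_ j'): h2.
  by rewrite jj jl.
- move=> i i' j ii jl; move/forallP/(_ i)/forallP/(_ i')/forallP/(_ j): h3.
  by rewrite ii jl.
- by move=> k kN; move/forallP/(_ (Ordinal kN))/eqP: h4.
- by move=> x /eqP e; move/forallP/(_ x): h5; rewrite e.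
- by apply/forallP => i; apply/forallP => j; apply/eqP.
- apply/forallP => i; apply/forallP => j; apply/forallP => j'.
  by apply/implyP => /andP[]; apply: h2.
- apply/forallP => i; apply/forallP => i'; apply/forallP => j.
  by apply/implyP => /andP[]; apply: h3.
- by apply/forallP => -[k kN]; apply/eqP/h4.
- by apply/forallP => x; apply/implyP => /eqP/h5.
Qed.

Lemma tab_le lam mu r T x : T \in tab lam mu r -> T x <= size mu.
Proof.
case/tabP=> _ _ _ hc _; rewrite leqNgt; apply/negP => h.
case e: (T x : nat) h => [|k] // h.
have kN : k < N by have := ltn_ord (T x); rewrite e.
have := hc k kN; rewrite nth_default // => /eqP; rewrite cards_eq0 => /eqP/setP/(_ x).
by rewrite !inE e eqxx.
Qed.

Lemma eq_tab lam lam' mu r : lam =1 lam' -> tab lam mu r = tab lam' mu r.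
Proof.
move=> e; apply/setP => T; apply/tabP/tabP => -[h1 h2 h3 h4 h5].
  by split=> // *; rewrite -?e ?h1 //; [apply: h2 | apply: h3]; rewrite ?e.
by split=> // *; rewrite ?e ?h1 //; [apply: h2 | apply: h3]; rewrite -?e.
Qed.

Lemma tab_antimono lam mu r s : r <= s -> tab lam mu s \subset tab lam mu r.
Proof.
move=> rs; apply/subsetP => T /tabP[h1 h2 h3 h4 h5]; apply/tabP; split=> // x /h5.
exact: leq_trans.
Qed.

(** With a last part 0 the largest possible entry does not occur, which voids the condition on its
    rows. *)
Lemma tab_rcons0 lam mu r : tab lam (rcons mu 0) r = tab lam mu 0.
Proof.
have e k : nth 0 (rcons mu 0) k = nth 0 mu k.
  by rewrite nth_rcons; case: ltngtP => // *; rewrite nth_default //; lia.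
apply/setP => T; apply/idP/idP => /[dup] hT /tabP[h1 h2 h3 h4 h5]; apply/tabP; split=> //.
- by move=> k kN; rewrite h4 ?e.
- by move=> k kN; rewrite h4 ?e.
- by rewrite size_rcons => x ex; have := tab_le x hT; rewrite ex ltnn.
Qed.

(** A largest entry in row [r] would have a box below it, and that box would need a larger entry. *)
Lemma tab_skip lam mu r : (forall i, a <= i -> lam i = 0) -> lam r = lam r.+1 ->
  0 < size mu -> tab lam mu r = tab lam mu r.+1.
Proof.
move=> la lr mu0; apply/eqP; rewrite eqEsubset (tab_antimono _ _ (leqnSn r)) andbT.
apply/subsetP => T /[dup] hT /tabP[h1 h2 h3 h4 h5]; apply/tabP; split=> // -[i j] e.
rewrite ltn_neqAle h5 // andbT; apply/eqP => /= ri.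
have jl : j < lam i.
  by rewrite h1; apply/eqP => z; move: e; rewrite z /=; lia.
rewrite -ri lr in jl; have ra : r.+1 < a.
  by rewrite ltnNge; apply/negP => /la; lia.
have := h3 i (Ordinal ra) j; rewrite -ri => /(_ (leqnn _) jl).
by rewrite e ltnNge (tab_le _ hT).
Qed.

(** The [k.+1] copies of the largest entry would have to lie in rows without boxes. *)
Lemma tab_stuck lam mu k r : size mu < N -> (forall i, r <= i -> lam i = 0) ->
  tab lam (rcons mu k.+1) r = set0.
Proof.
move=> muN lr; apply/setP => T; rewrite in_set0; apply/negbTE/negP => /tabP[h1 _ _ h4 h5].
have := h4 _ muN; rewrite nth_rcons ltnn eqxx => e.
have /card_gt0P[x] : 0 < #|[set x | T x == (size mu).+1 :> nat]| by rewrite e.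
rewrite inE => /eqP ex; have := h5 x; rewrite size_rcons => /(_ ex) /lr.
by case: x ex => i j /= ex l0; have := h1 i j; rewrite l0 ltn0 => /esym/eqP z; rewrite z in ex.
Qed.

Lemma tab_nil lam r : (forall i, lam i = 0) -> tab lam [:: 0] r = [set [ffun=> ord0]].
Proof.
move=> l0; apply/setP => T; rewrite in_set1; apply/tabP/eqP => [[h1 _ _ _ _]|->].
  by apply/ffunP => -[i j]; rewrite ffunE; have := h1 i j; rewrite l0 ltn0 => /esym/eqP.
split=> [i j|i j j' *|i i' j|k kN|x]; rewrite ?ffunE ?l0 //.
  rewrite (_ : nth _ _ _ = 0); last by case: k kN => [|[]].
  by apply/eqP; rewrite cards_eq0; apply/eqP/setP => x; rewrite !inE ffunE.
Qed.

Definition upd T x v : fil := [ffun y => if y == x then v else T y].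

Definition remove_box lam r i := if i == r then (lam i).-1 else lam i.

Section Branch.
Variables (lam : nat -> nat) (mu : seq nat) (k r : nat).
Hypotheses (lam_a : forall i, a <= i -> lam i = 0) (lam_b : lam r <= b).
Hypothesis lam_r : forall i, r < i -> lam i < lam r.
Hypothesis mu_N : size mu < N.

Lemma corner_row : r < a.
Proof. by rewrite ltnNge; apply/negP => /lam_a e; have := lam_r (leqnn _); rewrite e. Qed.

Lemma corner_col : (lam r).-1 < b.
Proof. by have := lam_r (leqnn _); lia. Qed.

Definition corner : box := (Ordinal corner_row, Ordinal corner_col).

Definition top : 'I_N.+1 := Ordinal (mu_N : (size mu).+1 < N.+1).

Lemma updE T v i j : upd T corner v (i, j) =
  if (i == r :> nat) && (j == (lam r).-1 :> nat) then v else T (i, j).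
Proof. by rewrite ffunE. Qed.

Lemma remove_corner T : T \in tab lam (rcons mu k.+1) r -> T corner = top ->
  upd T corner ord0 \in tab (remove_box lam r) (rcons mu k) r.
Proof.
move=> /[dup] hT /tabP[h1 h2 h3 h4 h5] tc; have l0 := lam_r (leqnn _).
apply/tabP; split=> [i j|i j j' jj jl|i i' j ii jl|v vN|[i j]].
- rewrite updE /remove_box; case: (nat_of_ord i =P r) => [ir|_] /=; last exact: h1.
  case: (nat_of_ord j =P (lam r).-1) => [->|jn]; first by rewrite ir ltnn eqxx.
  by rewrite -h1 ir; lia.
- have jl' : j' < lam i by move: jl; rewrite /remove_box; case: eqP => // ->; lia.
  rewrite !updE; case: ifP => // _; case: ifP => [/andP[/eqP ir /eqP jr]|_]; last exact: h2.
  by move: jl; rewrite /remove_box ir eqxx jr ltnn.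
- have jl' : j < lam i' by move: jl; rewrite /remove_box; case: eqP => // ->; lia.
  rewrite !updE; case: ifP => [/andP[/eqP ir /eqP jr]|_].
    by have := @lam_r i'; rewrite -ir => /(_ ii); rewrite ir; lia.
  case: ifP => [/andP[/eqP ir /eqP jr]|_]; last exact: h3.
  by move: jl; rewrite /remove_box ir eqxx jr ltnn.
- have hv := h4 v vN; rewrite !nth_rcons in hv *.
  have -> : [set x | upd T corner ord0 x == v.+1 :> nat] =
            [set x | T x == v.+1 :> nat] :\ corner.
    by apply/setP => x; rewrite !inE ffunE; case: (x =P corner).
  have := cardsD1 corner [set x | T x == v.+1 :> nat].
  rewrite hv inE tc /= eqSS; case: (ltngtP v (size mu)) => /= *; lia.
- rewrite updE !size_rcons; case: ifP => // _ e.
  by apply: (h5 (i, j)); rewrite size_rcons.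
Qed.

(** The column of the corner stays strict because lateness keeps the other copies of the largest
    entry out of the rows above. *)
Lemma add_corner T : T \in tab (remove_box lam r) (rcons mu k) r ->
  upd T corner top \in tab lam (rcons mu k.+1) r.
Proof.
move=> /[dup] hT /tabP[h1 h2 h3 h4 h5]; have l0 := lam_r (leqnn _).
have le_top x : T x <= top by rewrite (leq_trans (tab_le x hT)) // size_rcons.
have tc : T corner = ord0.
  by apply/eqP; rewrite -[_ == _]negbK -h1 /remove_box eqxx ltnn.
apply/tabP; split=> [i j|i j j' jj jl|i i' j ii jl|v vN|[i j]].
- rewrite updE; case: ifP => [/andP[/eqP ir /eqP jr]|hn].
    by rewrite ir jr (_ : _ < _) //; lia.
  rewrite -h1 /remove_box; case: eqP => // ir; move: hn; rewrite ir eqxx /=; lia.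
- rewrite !updE; case: (boolP (_ && (j' == _ :> nat))) => [_|hn].
    by case: ifP => // _; apply: le_top.
  case: ifP => [/andP[/eqP ir /eqP jr]|_].
    by move: hn jl; rewrite ir eqxx /=; lia.
  apply: h2 => //; rewrite /remove_box; case: eqP => // ir.
  by move: hn jl; rewrite ir eqxx /=; lia.
- rewrite !updE; case: ifP => [/andP[/eqP ir /eqP jr]|_].
    by have := @lam_r i'; rewrite -ir => /(_ ii); rewrite ir; lia.
  case: ifP => [/andP[/eqP ir /eqP jr]|hn].
    rewrite ltn_neqAle le_top andbT; apply/eqP => e.
    by have := h5 (i, j); rewrite size_rcons => /(_ e) /=; lia.
  apply: h3 => //; rewrite /remove_box; case: eqP => // ir.
  by move: hn jl; rewrite ir eqxx /=; lia.
- have hv := h4 v vN; rewrite !nth_rcons in hv *.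
  have := cardsD1 corner [set x | upd T corner top x == v.+1 :> nat].
  have -> : [set x | upd T corner top x == v.+1 :> nat] :\ corner =
            [set x | T x == v.+1 :> nat].
    apply/setP => x; rewrite !inE ffunE; case: (x =P corner) => // ->.
    by rewrite tc.
  rewrite hv inE ffunE eqxx /= eqSS; case: (ltngtP v (size mu)) => /= *; lia.
- rewrite updE; case: ifP => [/andP[/eqP -> _]|_] //.
  by rewrite !size_rcons => e; apply: (h5 (i, j)); rewrite size_rcons.
Qed.

(** Rows increase weakly, so a largest entry anywhere in row [r] forces one into the corner at its
    end. *)
Lemma tab_no_corner :
  tab lam (rcons mu k.+1) r :\: [set T : fil | T corner == top] = tab lam (rcons mu k.+1) r.+1.
Proof.
have l0 := lam_r (leqnn _).
apply/setP => T; rewrite in_setD inE; apply/andP/idP => [[tc /[dup] hT /tabP[h1 h2 h3 h4 h5]]|].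
  apply/tabP; split=> // -[i j] e; rewrite ltn_neqAle h5 // andbT; apply/eqP => /= ri.
  have jl : j < lam i.
    by rewrite h1; apply/eqP => z; move: e; rewrite z size_rcons.
  case/eqP: tc; apply: val_inj => /=; apply/eqP; rewrite eqn_leq.
  have := tab_le corner hT; rewrite size_rcons => -> /=.
  rewrite size_rcons in e; rewrite -e.
  have -> : i = corner.1 by apply: val_inj.
  by apply: (h2 corner.1 j corner.2) => /=; move: jl; rewrite -ri; lia.
move=> /tabP[h1 h2 h3 h4 h5]; split.
  by apply/eqP => e; have := h5 corner; rewrite e size_rcons /= ltnn => /(_ erefl).
by apply/tabP; split=> // x /h5 /ltnW.
Qed.

(** The recursion behind a branching of the search: either the corner carries the largest entry and
    is removed, or row [r] is finished for this entry. *)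
Lemma card_tab_branch :
  #|tab lam (rcons mu k.+1) r| =
  #|tab (remove_box lam r) (rcons mu k) r| + #|tab lam (rcons mu k.+1) r.+1|.
Proof.
rewrite -(cardsID [set T : fil | T corner == top]) tab_no_corner; congr (_ + _).
rewrite -(@card_in_imset _ _ (fun T => upd T corner ord0)); last first.
  move=> T T' /setIP[_ ]; rewrite inE => /eqP e /setIP[_ ]; rewrite inE => /eqP e' /ffunP h.
  apply/ffunP => x; have := h x; rewrite !ffunE.
  by case: (x =P corner) => // ->; rewrite e e'.
congr #|pred_of_set _|; apply/setP => T; apply/imsetP/idP => [[T']|hT].
  by case/setIP=> hT'; rewrite inE => /eqP e ->; apply: remove_corner.
exists (upd T corner top).
  by apply/setIP; split; [exact: add_corner | rewrite inE ffunE !eqxx].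
have [h1 _ _ _ _] := elimT (tabP _ _ _ _) hT.
have tc : T corner = ord0.
  by apply/eqP; rewrite -[_ == _]negbK -h1 /remove_box eqxx ltnn.
by apply/ffunP => x; rewrite !ffunE; case: (x =P corner) => // ->.
Qed.
End Branch.

End Tableaux.

(** * The search tree *)

Implicit Types (x : bsym) (l r m w : seq bsym).

Lemma size_rowlen w : size (rowlen w) = count_mem Sep w.
Proof. by elim: w => [|[] w IH] //=; rewrite IH. Qed.

Lemma rowlen_cat u v :
  rowlen (u ++ v) = [seq k + count_mem One v | k <- rowlen u] ++ rowlen v.
Proof. by elim: u => [|[] u IH] //=; rewrite IH count_cat. Qed.

Lemma nth_rowlen_cat u v i : nth 0 (rowlen (u ++ v)) i =
  if i < count_mem Sep u then nth 0 (rowlen u) i + count_mem One v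
  else nth 0 (rowlen v) (i - count_mem Sep u).
Proof.
rewrite rowlen_cat nth_cat size_map size_rowlen; case: ltnP => // h.
by rewrite (nth_map 0) ?size_rowlen.
Qed.

Lemma nth_rowlen_le w i : nth 0 (rowlen w) i <= count_mem One w.
Proof. by elim: w i => [|[] w IH] [|i] //=; rewrite ?leqW ?add0n ?add1n ?leqW. Qed.

(* The row of the first box that can be removed when the cursor is right of l. *)
Definition row (l : seq bsym) := count_mem Sep l - (ohead l == Some Sep).

Lemma rowlen_swap l r : nth 0 (rowlen (catrev l (One :: Sep :: r))) =1
  remove_box (nth 0 (rowlen (catrev l (Sep :: One :: r)))) (count_mem Sep l).
Proof.
move=> i; rewrite !catrevE /remove_box !nth_rowlen_cat !count_rev /=.
by case: (ltngtP i (count_mem Sep l)) => [h|h|->]; rewrite ?subnn // -(subnSK h).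
Qed.

Lemma sumn_rowlen_swap l r : sumn (rowlen (catrev l (Sep :: One :: r))) =
  (sumn (rowlen (catrev l (One :: Sep :: r)))).+1.
Proof. by rewrite !catrevE !rowlen_cat !sumn_cat /= add1n addSn addnS. Qed.

(** The column step after the bar counts for the row of this bar but for no row below. *)
Lemma corner_max l r i : count_mem Sep l < i ->
  nth 0 (rowlen (catrev l (Sep :: One :: r))) i <
  nth 0 (rowlen (catrev l (Sep :: One :: r))) (count_mem Sep l).
Proof.
move=> h; rewrite !catrevE !nth_rowlen_cat !count_rev ltnn subnn.
rewrite [i < count_mem _ _]ltnNge (ltnW h) /=.
by rewrite -(subnSK h) /= add1n ltnS nth_rowlen_le.
Qed.

Lemma row_Sep l : row (Sep :: l) = count_mem Sep l.
Proof. by rewrite /row /= add1n subn1. Qed.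

Lemma row_One l : row (One :: l) = count_mem Sep l.
Proof. by rewrite /row /= subn0. Qed.

(* The part of mu still to be used, the current block first; a Sep in front of it
   means that the current block is used up. *)
Fixpoint blocks (m : seq bsym) : seq nat :=
  match m with
  | [::] => [:: 0]
  | One :: m' => (head 0 (blocks m')).+1 :: behead (blocks m')
  | _ :: m' => 0 :: blocks m'
  end.

Lemma blocksE m : blocks m = head 0 (blocks m) :: behead (blocks m).
Proof. by case: m => [|[] m]. Qed.

Lemma sumn0 s i : sumn s = 0 -> nth 0 s i = 0.
Proof. by elim: s i => [|x s IH] [|i] //= /eqP; rewrite addn_eq0 => /andP[/eqP ? /eqP /IH]. Qed.

(** * Leaves of the search tree and tableaux *)

Section Count.
Variables a b N : nat.

(** Boundary words whose diagram lies in the [a] by [b] rectangle; trailing empty rows, such as the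
    additional one at the bottom, are allowed. *)
Definition fits w := word_ok w /\
  forall i, nth 0 (rowlen w) i <= b /\ (a <= i -> nth 0 (rowlen w) i = 0).

Lemma fits_swap l r : fits (catrev l (Sep :: One :: r)) -> fits (catrev l (One :: Sep :: r)).
Proof.
case=> okw h; split=> [|i].
  by move: okw; rewrite !catrevE /word_ok !all_cat.
have [h1 h2] := h i; rewrite rowlen_swap /remove_box; case: eqP => // e; split; first by lia.
by move=> ai; rewrite h2.
Qed.

Notation ctab w mu r := #|tab a b N (nth 0 (rowlen w)) mu r|.

(** Without a branching, [row] changes only when the cursor passes the second of two adjacent bars;
    these two rows are equally long, and [tab_skip] applies. *)
Lemma ctab_advance (mu : seq nat) l x r : fits (catrev l (x :: r)) -> 0 < size mu ->
  ~~ branching l (x :: r) ->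
  ctab (catrev l (x :: r)) mu (row (x :: l)) = ctab (catrev l (x :: r)) mu (row l).
Proof.
move=> [okw h] m0 nb.
have okx : predU1 One (pred1 Sep) x.
  by move: okw; rewrite catrevE /word_ok all_cat => /and3P[].
case: x okx okw h nb => // _ okw h.
  by rewrite row_One /row /= eqxx andbT => /negPf ->; rewrite subn0.
move=> _; rewrite row_Sep; have [hl|hl] := eqVneq (ohead l) (Some Sep); last first.
  by rewrite /row (negPf hl) subn0.
case: l okw h hl => [|x l] //= okw h [ex]; subst x.
rewrite row_Sep add1n [in RHS](@tab_skip) //; first by move=> i; apply: (h i).2.
by rewrite catrevE !nth_rowlen_cat count_rev ltnn subnn ltnNge leqnSn /= subSnn.
Qed.

Lemma ctab_branch mu k l r : fits (catrev l (Sep :: One :: r)) -> size mu < N ->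
  let w := catrev l (Sep :: One :: r) in
  ctab w (rcons mu k.+1) (count_mem Sep l) =
  ctab (catrev l (One :: Sep :: r)) (rcons mu k) (count_mem Sep l) +
  ctab w (rcons mu k.+1) (count_mem Sep l).+1.
Proof.
move=> [okw h] mN w; rewrite (eq_tab _ _ _ _ _ (rowlen_swap l r)); apply: card_tab_branch => //.
- by move=> i; apply: (h i).2.
- exact: (h _).1.
- by move=> i; apply: corner_max.
Qed.

(** Each constructor of [tree] matches a rule for tableaux: [tab_rcons0] for rewinding and for a new
    block, [tab_stuck] for a dead end, [ctab_advance] and [ctab_branch] for the sweep. Unless [m]
    starts with [One], [blocks m] starts with an exhausted part 0, hence the correction in the bound
    by [N]. *)
Lemma tree_count m l r c n f : tree m l r c n f -> fits (catrev l r) ->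
  count_mem One m = sumn (rowlen (catrev l r)) ->
  size (blocks m) <= N + (ohead m != Some One) ->
  c = ctab (catrev l r) (rev (blocks m)) (row l).
Proof.
elim=> {m l r c n f} [l r|m x l r c n f _ IH|m r c n f _ IH|m l|m l x r c n f nb _ IH
  |m l r c1 n1 f1 c2 n2 f2 _ IH1 _ IH2] /= fw cs sm.
(* No boxes remain, and the empty filling is the only tableau. *)
- by rewrite tab_nil ?cards1 // => i; apply: sumn0.
- by rewrite IH //= rev_cons !tab_rcons0.
- rewrite (IH fw) //=; first by rewrite rev_cons tab_rcons0.
  by move: sm; rewrite addn1 ltnS => /leq_trans; apply; rewrite leq_addr.
- rewrite rev_cons tab_stuck ?cards0 ?size_rev //; first by move: sm; rewrite addn0.
  (* With the cursor at the right end, the only bar that can belong to a row from [row l] on is the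
     last letter, and no column step follows it. *)
  move=> i; rewrite catrevE cats0; case: l {fw cs} => [|x l]; first by rewrite nth_nil.
  move=> hi; rewrite rev_cons -cats1 nth_rowlen_cat count_rev.
  have {}hi : count_mem Sep l <= i.
    by move: hi; case: (x); rewrite /row /= ?subn0 ?add1n ?subn1 ?add0n.
  by rewrite ltnNge hi /=; case: (x); case: (i - _) => [|[]].
- by rewrite (IH fw) // -ctab_advance // size_rev.
- rewrite row_Sep rev_cons ctab_branch //; last first.
    by rewrite size_rev; move: sm; rewrite addn0.
  rewrite (IH2 fw) //= row_One /= add1n rev_cons; congr (_ + _).
  rewrite (IH1 (fits_swap fw)).
  + by rewrite row_Sep /= -rev_cons -blocksE.
  + by move: cs; rewrite [catrev _ _]/(catrev l (Sep :: One :: r)) sumn_rowlen_swap add1n => -[].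
  + by move: sm; rewrite [blocks m]blocksE /= addn0 => /leq_trans; apply; rewrite leq_addr.
Qed.

(** The last bar of a nonempty row is followed by a column step, since a second bar there would mark
    a row of the same length. *)
Lemma find_corner w : word_ok w -> 0 < sumn (rowlen w) ->
  exists l r, w = catrev l (Sep :: One :: r).
Proof.
move=> okw sw; suff [u [r ->]] : exists u r, w = u ++ Sep :: One :: r.
  by exists (rev u), r; rewrite catrevE revK.
elim: w okw sw => //= x w IH /andP[okx okw].
have [w0|wp] := posnP (sumn (rowlen w)); last first.
  by have [u [r ->]] := IH okw wp; exists (x :: u), r.
case: x okx => // _ /= h; first by rewrite w0 in h.
rewrite w0 addn0 in h; case: w okw h w0 {IH} => [|[] w] //= _ h w0.
  by exists [::], w.
by move: h w0; lia.
Qed.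

Lemma nseq_rcons1 v : 1 :: nseq v 1 = rcons (nseq v 1) 1.
Proof. by elim: v => //= v <-. Qed.

(** A standard tableau is built by putting the largest entry into any corner and recursing. *)
Lemma ctab_gt0 v w : fits w -> sumn (rowlen w) = v -> v <= N -> 0 < ctab w (nseq v 1) 0.
Proof.
elim: v w => [|v IH] w fw sw vN.
  by rewrite -(tab_rcons0 _ _ _ _ _ 0) tab_nil ?cards1 // => i; apply: sumn0.
have [|l [r e]] := find_corner fw.1; first by rewrite sw.
subst w.
apply: leq_trans (subset_leq_card (tab_antimono _ _ _ _ _ (leq0n (count_mem Sep l)))).
rewrite /= nseq_rcons1 ctab_branch // ?size_nseq // addn_gt0 tab_rcons0 IH ?(ltnW vN) //.
  exact: fits_swap.
by move: sw; rewrite sumn_rowlen_swap => -[].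
Qed.

(** Leaves are charged to standard tableaux, that is, to content [nseq v 1]; within a block their
    largest entry must lie in the rows still to be swept. If a branching has [x] tableaux after the
    removal and [y] for the later rows, then [(1 + v * x) + (1 + v.+1 * y)] is at most
    [1 + v.+1 * (x + y)], because [x] is positive by [ctab_gt0]. This also pays for the dead
    branches. *)
Lemma tree_leaves m l r c n f : tree m l r c n f ->
  fits (catrev l r) -> forall v, sumn (rowlen (catrev l r)) = v -> v <= N ->
  f <= 1 + v * ctab (catrev l r) (nseq v 1) (if ohead m == Some One then row l else 0).
Proof.
elim=> {m l r c n f} [l r|m x l r c n f _ IH|m r c n f _ IH|m l|m l x r c n f nb _ IH
  |m l r c1 n1 f1 c2 n2 f2 _ IH1 _ IH2] /= fw v sv vN //.
- exact: IH.
- by apply: leq_trans (IH fw v sv vN) _; case: ifP.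
- have {}IH := IH fw v sv vN; case: v IH {sv vN} => [|v] IH //.
  by rewrite -ctab_advance ?size_nseq.
- have sv' := sv; rewrite [catrev _ _]/(catrev l (Sep :: One :: r)) sumn_rowlen_swap in sv'.
  case: v sv sv' vN => // v sv [sv'] vN.
  have := IH2 fw _ sv vN; rewrite row_One /= add1n => h2.
  have h1 := IH1 (fits_swap fw) _ sv' (ltnW vN).
  rewrite row_Sep nseq_rcons1 ctab_branch ?size_nseq // tab_rcons0.
  have g0 := ctab_gt0 (fits_swap fw) sv' (ltnW vN).
  (* In a standard tableau the next smaller entry may lie in any row, so the condition on its row is
     relaxed to 0. *)
  have s1 := subset_leq_card (@tab_antimono a b N (nth 0 (rowlen (catrev l (One :: Sep :: r))))
    (nseq v 1) 0 (if ohead m == Some One then row (Sep :: One :: l) else 0) (leq0n _)).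
  have {}h1 := leq_trans h1 (leq_add (leqnn 1) (leq_mul (leqnn v) s1)).
  rewrite -nseq_rcons1.
  by rewrite mulnDr; move: h1 h2 g0; rewrite !mulSn; lia.
Qed.
End Count.

(** * Depth and number of nodes of the search tree *)

(** Bounds the length of a path to a leaf and serves as termination measure. Each later block is
    charged [W.+1.*2] for one rewinding and one sweep of the word; the other summands cover what is
    left of the current ones. *)
Definition depth (m l r : seq bsym) :=
  let W := size l + size r in
  if ohead m == Some Sep then W.+1.*2 * count_mem Sep (behead m) + size l + W + 2
  else W.+1.*2 * count_mem Sep m + size r + 1.

Lemma depth_gt0 m l r : 0 < depth m l r.
Proof. by rewrite /depth; case: ifP; rewrite !addnS. Qed.

Lemma depth_rewind m x l r :
  depth (Sep :: m) l (x :: r) < depth (Sep :: m) (x :: l) r.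
Proof. by rewrite /depth /= !addSnnS; lia. Qed.

Lemma depth_block m r : depth m [::] r < depth (Sep :: m) [::] r.
Proof.
by rewrite /depth /=; case: m => [|[] m] /=; nia.
Qed.

Lemma depth_advance m x l r : depth (One :: m) (x :: l) r < depth (One :: m) l (x :: r).
Proof. by rewrite /depth /= !addSnnS; lia. Qed.

Lemma depth_swap m l r :
  depth m (Sep :: One :: l) r < depth (One :: m) (Sep :: l) (One :: r).
Proof.
rewrite /depth /= [_.+2 + _]addSnnS; set W := _ + (size r).+1.
have : size l + 2 + size r <= W by rewrite /W; lia.
by case: m => [|[] m] /=; nia.
Qed.

Lemma ltn_mul_step n d d' f : 0 < f -> n <= d * f -> d < d' -> n < d' * f.
Proof. by move=> f0 h dd; apply: leq_ltn_trans h _; rewrite ltn_pmul2r. Qed.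

(** All nodes lie on the [f] paths to the leaves, each with at most [depth m l r] nodes. *)
Lemma tree_nodes m l r c n f : tree m l r c n f -> 0 < f /\ n <= depth m l r * f.
Proof.
elim=> {m l r c n f} [l r|m x l r c n f _ [f0 IH]|m r c n f _ [f0 IH]|m l
  |m l x r c n f nb _ [f0 IH]|m l r c1 n1 f1 c2 n2 f2 _ [f0 IH1] _ [g0 IH2]]; split=> //.
- by rewrite muln1 depth_gt0.
- exact: ltn_mul_step f0 IH (depth_rewind _ _ _ _).
- exact: ltn_mul_step f0 IH (depth_block _ _).
- by rewrite muln1 depth_gt0.
- exact: ltn_mul_step f0 IH (depth_advance _ _ _ _).
- by rewrite addn_gt0 f0.
- rewrite mulnDr -addSn leq_add //.
    exact: ltn_mul_step f0 IH1 (depth_swap _ _ _).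
  exact: ltnW (ltn_mul_step g0 IH2 (depth_advance _ _ _ _)).
Qed.

(** Termination of the search, by induction on [depth]. *)
Lemma tree_exists m l r : word_ok m -> exists c n f, tree m l r c n f.
Proof.
have [d] := ubnP (depth m l r); elim: d m l r => // d IH m l r hd okm.
case: m okm hd => [|x m] /=; first by exists 1, 1, 1; constructor.
case: x => // okm hd.
- case: r hd => [|x r] hd; first by exists 0, 1, 1; constructor.
  have [c2 [n2 [f2 t2]]] := IH (One :: m) (x :: l) r (leq_trans (depth_advance _ _ _ _) hd) okm.
  case nb: (branching l (x :: r)); last first.
    by exists c2, n2.+1, f2; constructor; rewrite ?nb.
  case: l x nb hd t2 => [|[] l] [] //= _ hd t2.
  have [c1 [n1 [f1 t1]]] := IH m (Sep :: One :: l) r (leq_trans (depth_swap _ _ _) hd) okm.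
  by exists (c1 + c2), (n1 + n2).+1, (f1 + f2); constructor.
- case: l hd => [|x l] hd.
    have [c [n [f t]]] := IH m [::] r (leq_trans (depth_block _ _) hd) okm.
    by exists c, n.+1, f; constructor.
  have [c [n [f t]]] := IH (Sep :: m) l (x :: r) (leq_trans (depth_rewind _ _ _ _) hd) okm.
  by exists c, n.+1, f; constructor.
Qed.

(** * Kostka numbers *)

Lemma kostka_tab mu nu :
  kostka mu nu = #|tab (size nu) (head 0 nu) (size mu) (nth 0 nu) mu 0|.
Proof.
apply: eq_card => T; rewrite !inE.
suff -> : late 0 (size mu) T by rewrite andbT.
by apply/forallP => x; rewrite leq0n implybT.
Qed.

(** Every value occupies a single box, so entries that increase weakly along a row increase
    strictly. *)
Lemma tab_dim_irr nu :
  #|tab (size nu) (head 0 nu) (sumn nu) (nth 0 nu) (nseq (sumn nu) 1) 0| <= dim_irr nu.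
Proof.
apply/subset_leq_card/subsetP => T /[dup] /tabP[h1 h2 h3 h4 _].
rewrite !inE => /and5P[g1 _ g3 _ _]; apply/and4P; split=> //.
- apply/forallP => i; apply/forallP => j; apply/forallP => j'.
  apply/implyP => /andP[jj jl]; rewrite ltn_neqAle h2 ?(ltnW jj) // andbT.
  have := h1 i j; rewrite (ltn_trans jj jl) => /esym; rewrite -val_eqE /= => nz.
  apply/eqP => e; case ev: (T (i, j) : nat) nz e => [|v] // _ e.
  have vN : v < sumn nu by have := ltn_ord (T (i, j)); rewrite ev.
  have := h4 v vN; rewrite nth_nseq vN => /eqP/cards1P[x /setP hx].
  have := hx (i, j); have := hx (i, j'); rewrite !inE ev -e eqxx.
  move=> /esym/eqP <- /esym/eqP[] e'.
  by move: jj; rewrite e' ltnn.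
- by apply/forallP => -[k kN]; rewrite h4 // nth_nseq kN.
Qed.

Lemma size_enc_part la : size (enc_part la) = sumn la + size la.
Proof.
elim: la => //= k la IH; rewrite /enc_part /= size_cat size_rcons size_nseq.
by rewrite -[size (flatten _)]/(size (enc_part la)) IH; lia.
Qed.

Lemma count_enc_part la : count_mem One (enc_part la) = sumn la /\
  count_mem Sep (enc_part la) = size la.
Proof.
rewrite /enc_part; elim: la => //= k la [IH1 IH2].
by rewrite !count_cat -cats1 !count_cat !count_nseq /= IH1 IH2; lia.
Qed.

Lemma word_ok_enc_part la : word_ok (enc_part la).
Proof.
rewrite /word_ok /enc_part; elim: la => //= k la IH.
by rewrite all_cat IH all_rcons all_nseq orbT.
Qed.

Lemma blocks_enc_part la : blocks (rev (enc_part la)) = 0 :: rev la.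
Proof.
rewrite rev_enc_part; elim: (rev la) => //= k ks IH; congr (_ :: _).
by elim: k => [|k /= ->] /=.
Qed.

Lemma size_partition n la : is_partition n la -> size la <= n /\ head 0 la <= n.
Proof.
case/and3P => _ pos /eqP <-; split.
  by elim: la pos => //= x la IH /andP[x0 /IH]; lia.
by case: la {pos} => //= x la; rewrite leq_addr.
Qed.

Lemma nth_le_head la i : sorted geq la -> nth 0 la i <= head 0 la.
Proof.
case: la i => [|x la] [|i] //= h.
have /allP a : all (geq x) la.
  by apply: order_path_min h => u v w p q; apply: leq_trans q p.
have [il|li] := ltnP i (size la); last by rewrite nth_default.
by apply: a; rewrite mem_nth.
Qed.

Lemma computes_within_mono (M : TM) inp t u out :
  t <= u -> computes_within M inp t out -> computes_within M inp u out.
Proof.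
have runD k t' c : run (t' + k) c = run k (@run M t' c).
  elim: t' c => //= t' IH c; case e: (step c) => [c'|]; first exact: IH.
  by case: k {IH} => //= k; rewrite e.
move=> tu [h1 h2]; rewrite /computes_within -(subnKC tu) runD.
by case: (u - t) => [|k] /=; rewrite ?(step_halted h1).
Qed.

(* 83 = 12 + 17 * 4 + 3, and 14952 = (83 + 1) * 2 * (4 + 83 + 2). *)
Lemma kostka_time_bound p q d n s f N :
  d <= p * n.+1 ^ q -> f <= 1 + n * d -> N <= 4 * n.+1 ^ 2 * f -> s <= 4 * n + 1 ->
  exists2 t, 12 * n + 17 * N + 3 <= t &
    t.+1 * ((s + t).*2 + 4) <= 14952 * p.+1 ^ 2 * n.+1 ^ ((q + 3) * 2).
Proof.
(* In the exponent [q + 3], the [q] comes from the dimension, 1 from the factor [n] in the number of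
   leaves and 2 from the quadratic depth. *)
move=> hd hf hN hs; pose X := n.+1 ^ q; pose P := n.+1 ^ (q + 3); pose Z := p.+1 * P.
have X0 : 0 < X by rewrite expn_gt0.
have PX : P = n.+1 ^ 2 * (n.+1 * X) by rewrite /P addnC expnD expnSr mulnA.
have nP : n.+1 <= P by rewrite PX mulnCA leq_pmulr // muln_gt0 expn_gt0.
have PZ : P <= Z by rewrite leq_pmull.
have NZ : N <= 4 * Z.
  apply: leq_trans hN _; rewrite -mulnA leq_mul2l /= /Z PX mulnCA leq_mul2l; apply/orP; right.
  apply: leq_trans hf _; apply: leq_trans (_ : X + n * (p * X) <= _).
    by rewrite leq_add // leq_mul2l hd orbT.
  rewrite [_ * (_ * X)]mulnA -mulSn mulnA leq_mul2r; apply/orP; right.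
  by rewrite mulSn mulnS; lia.
exists (83 * Z); first by lia.
have -> : 14952 * p.+1 ^ 2 * n.+1 ^ ((q + 3) * 2) = (84 * Z) * (178 * Z).
  by rewrite expnM -/P mulnACA -[84 * 178]/14952 -mulnA -expnMn -/Z -mulnn.
by apply: leq_mul; lia.
Qed.

Lemma depth_nil m r :
  depth m [::] r <= (size r).+1.*2 * count_mem Sep m + size r + 1.
Proof. by rewrite /depth /=; case: m => [|[] m] /=; nia. Qed.

Theorem theorem2 :
  exists M : TM,
    forall a b : nat,
      exists C k : nat,
        forall (n : nat) (mu nu : seq nat),
          is_partition n mu -> is_partition n nu ->
          dim_irr nu <= a * n.+1 ^ b ->
          computes_within M (enc_pair mu nu) (C * n.+1 ^ k) (kostka mu nu).
Proof.
exists kostka_machine => p q; exists (14952 * p.+1 ^ 2), ((q + 3) * 2) => n mu nu pmu pnu hd.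
have /and3P[_ _ /eqP smu] := pmu; have /and3P[nu_sorted _ /eqP snu] := pnu.
have [zmu _] := size_partition pmu; have [znu hnu] := size_partition pnu.
have [w [wnu okw sw run]] := kostka_machine_run mu nu_sorted.
have okmu : word_ok (rev (enc_part mu)) by rewrite /word_ok all_rev; exact: word_ok_enc_part.
have [c [N [f t]]] := tree_exists [::] w okmu.
(* The additional empty row agrees with the default value 0 of [nth]. *)
have nthw : nth 0 (rowlen w) =1 nth 0 nu.
  move=> i; rewrite wnu nth_rcons; case: ltngtP => // h; rewrite nth_default //.
    exact: ltnW.
  by rewrite h.
have fw : fits (size nu) (head 0 nu) w.
  by split=> // i; rewrite nthw; split; [exact: nth_le_head | exact: nth_default].
have sumw : sumn (rowlen w) = n by rewrite wnu sumn_rcons addn0.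
have ck : c = kostka mu nu.
  rewrite (tree_count (N := size mu) t fw).
  - by rewrite blocks_enc_part rev_cons revK tab_rcons0 kostka_tab (eq_tab _ _ _ _ _ nthw).
  - by rewrite count_rev (count_enc_part mu).1 smu -sumw.
  - rewrite blocks_enc_part /= size_rev rev_enc_part.
    by case: (rev mu) => [|x s] /=; rewrite addn1.
have hf : f <= 1 + n * dim_irr nu.
  (* The leaves are compared with standard tableaux, whose entries go up to [n], whereas the count
     above used entries up to [size mu]. *)
  apply: leq_trans (tree_leaves t fw sumw (leqnn n)) _.
  rewrite leq_add2l leq_mul2l; apply/orP; right.
  apply: leq_trans (tab_dim_irr nu); rewrite snu (eq_tab _ _ _ _ _ nthw).
  exact: subset_leq_card (tab_antimono _ _ _ _ _ (leq0n _)).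
have hN : N <= 4 * n.+1 ^ 2 * f.
  (* The word has at most [2 * n + 1] letters and [mu] at most [n] parts, so the depth is at most
     [4 * n.+1 * n + 2 * n.+1]. *)
  apply: leq_trans (tree_nodes t).2 _; rewrite leq_mul2r; apply/orP; right.
  apply: leq_trans (depth_nil _ _) _; rewrite count_rev (count_enc_part mu).2 sw expnS expn1.
  apply: leq_trans (_ : (4 * n.+1) * n + 2 * n.+1 <= _); last by nia.
  by rewrite -addnA leq_add ?leq_mul //; lia.
have hs : size (enc_pair mu nu) <= 4 * n + 1.
  by rewrite size_cat /= !size_enc_part smu snu; lia.
have [t0 ht0 bound] := kostka_time_bound hd hf hN hs.
rewrite -ck; apply: computes_within_mono bound (run _ _ _ _ t _).
by apply: leq_trans ht0; rewrite snu; lia.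
Qed.
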